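(* Any (possibly singular) toric del Pezzo surface whose automorphism group acts transitively on the set of torus-invariant points has at most six torus-invariant points.
   Context: A (possibly singular, i.e. log) del Pezzo surface is a normal complex surface $X$ with ample $\mathbb{Q}$-Cartier anticanonical divisor $-K_X$ and at worst log terminal singularities. Toric such surfaces correspond, via the spanning fan (the fan of cones over the faces), to LDP-polygons: lattice polygons containing the origin in their interior and having primitive vertices (a nonzero lattice point is primitive if the segment joining it to the origin contains no other lattice points). A torus-invariant point is a point of $X$ fixed by the big torus. *)

(* Defs.v *)
From HB Require Import structures.
From mathcomp Require Import all_boot all_order all_algebra.
From mathcomp Require Import all_classical all_reals all_analysis.
From mathcomp Require Import complex.

Set Implicit Arguments.
Unset Strict Implicit.
Unset Printing Implicit Defensive.

Import Order.TTheory GRing.Theory Num.Theory.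
Import numFieldNormedType.Exports.

Local Open Scope classical_set_scope.
Local Open Scope ring_scope.
Local Open Scope complex_scope.

(* The lattices N (containing the polygons) and M = Hom(N, Z) are both
   identified with Z^2, the duality being the standard scalar product. *)
Definition lattice : Type := (int * int)%type.

Section Polygons.
Variable R : realType.
Implicit Types (P F : set (R * R)) (x y w : R * R).

Definition dot w x : R := w.1 * x.1 + w.2 * x.2.

Definition lat (v : lattice) : R * R := (v.1%:~R, v.2%:~R).

Definition convex_hull (V : seq lattice) : set (R * R) :=
  [set x | exists c : lattice -> R,
     [/\ forall v, 0 <= c v,
         \sum_(v <- V) c v = 1 &
         x = \sum_(v <- V) c v *: lat v]].

Definition lattice_polytope P := exists V : seq lattice, P = convex_hull V.

(* [w = 0] is allowed, so that the empty set and [P] itself are faces. *)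
Definition is_face P F := exists (w : R * R) (h : R),
  (forall x, P x -> dot w x <= h) /\ F = [set x | P x /\ dot w x = h].

Definition is_vertex P x := is_face P [set x].

Definition primitive (v : lattice) :=
  v <> 0 /\
  forall (u : lattice) (t : R),
    0 <= t <= 1 -> lat u = t *: lat v -> u = 0 \/ u = v.

(* Two-dimensionality of [P] is implied by the condition on the interior. *)
Definition LDP_polygon P :=
  [/\ lattice_polytope P,
      interior P (0 : R * R) &
      forall x, is_vertex P x -> exists2 v : lattice, x = lat v & primitive v].

Definition cone_over F : set (R * R) :=
  [set x | x = 0 \/ exists t y, [/\ 0 <= t, F y & x = t *: y]].

(* The proper face [F = set0] contributes the cone [{0}], whose chart is the
   torus. *)
Definition spanning_fan P : set (set (R * R)) :=
  [set sigma | exists F, [/\ is_face P F, F <> P & sigma = cone_over F]].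

End Polygons.

Section ToricSurface.
Variables (R : realType) (Sigma : set (set (R * R))).

(* The semigroup S_sigma, the intersection of M with the dual cone. *)
Definition dual_semigroup (sigma : set (R * R)) : set lattice :=
  [set m | forall x, sigma x -> 0 <= dot (lat R m) x].

(* The closed points of U_sigma = Spec C[S_sigma] are the monoid homomorphisms
   from S_sigma to the multiplicative monoid of C = [R[i]].  Such a homomorphism is
   a total function on M whose values outside S_sigma are never used. *)
Definition monoid_hom (sigma : set (R * R)) (g : lattice -> R[i]) :=
  g 0 = 1 /\
  forall m m', dual_semigroup sigma m -> dual_semigroup sigma m' ->
    g (m + m') = g m * g m'.

Record chart_point := ChartPoint {
  cone_of : set (R * R);
  eval_of : lattice -> R[i];
  cone_ofP : Sigma cone_of;
  eval_ofP : monoid_hom cone_of eval_of }.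

(* U_sigma and U_tau are glued along their common open subset
   U_(sigma `&` tau). *)
Definition glued (p q : chart_point) := exists g : lattice -> R[i],
  [/\ monoid_hom (cone_of p `&` cone_of q) g,
      forall m, dual_semigroup (cone_of p) m -> g m = eval_of p m &
      forall m, dual_semigroup (cone_of q) m -> g m = eval_of q m].

(* The set of closed points of the toric surface X_Sigma: the quotient of the
   disjoint union of the charts by [glued], a class being represented by the
   set of its members. *)
Definition toric_surface : Type :=
  {x : set chart_point | exists p, x = [set q | glued p q]}.

Definition pt (p : chart_point) : toric_surface :=
  exist _ [set q | glued p q] (ex_intro _ p erefl).

(* Elements of C[S_sigma], as lists of terms (coefficient, exponent). *)
Definition laurent : Type := seq (R[i] * lattice).

Definition in_semigroup_algebra (sigma : set (R * R)) (f : laurent) :=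
  forall a, a \in f -> dual_semigroup sigma a.2.

Definition leval (f : laurent) (p : chart_point) : R[i] :=
  \sum_(a <- f) a.1 * eval_of p a.2.

(* X_Sigma is viewed as a space with functions: its Zariski topology and its
   sheaf of regular functions. *)
Definition zariski_open (V : set toric_surface) :=
  forall p, V (pt p) -> exists h : laurent,
    [/\ in_semigroup_algebra (cone_of p) h, leval h p != 0 &
        forall q, cone_of q = cone_of p -> leval h q != 0 -> V (pt q)].

(* Values of [f] outside [V] are irrelevant. *)
Definition regular_on (V : set toric_surface) (f : toric_surface -> R[i]) :=
  forall p, V (pt p) -> exists g h : laurent,
    [/\ in_semigroup_algebra (cone_of p) g,
        in_semigroup_algebra (cone_of p) h, leval h p != 0 &
        forall q, cone_of q = cone_of p -> V (pt q) -> leval h q != 0 ->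
          f (pt q) = leval g q / leval h q].

Definition is_morphism (phi : toric_surface -> toric_surface) :=
  forall V, zariski_open V ->
    zariski_open (phi @^-1` V) /\
    forall f, regular_on V f -> regular_on (phi @^-1` V) (f \o phi).

(* Automorphisms of the variety over C; they need not be compatible with the
   action of the torus. *)
Definition is_automorphism (phi : toric_surface -> toric_surface) :=
  is_morphism phi /\
  exists psi, [/\ is_morphism psi, cancel phi psi & cancel psi phi].

Definition torus : Type := {t : R[i] * R[i] | (t.1 != 0) && (t.2 != 0)}.

Definition character (m : lattice) (t : torus) : R[i] :=
  (val t).1 ^ m.1 * (val t).2 ^ m.2.

Lemma torus_act_subproof (t : torus) (p : chart_point) :
  monoid_hom (cone_of p) (fun m => character m t * eval_of p m).
Proof.
have /andP[t10 t20] := valP t; case: (eval_ofP p) => g0 gM.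
split=> [|m m' sm sm'] /=; first by rewrite /character g0 !expr0z !mulr1.
by rewrite gM // /character !expfzDr // [RHS]mulrACA; congr (_ * _); exact: mulrACA.
Qed.

Definition torus_act (t : torus) (p : chart_point) : chart_point :=
  ChartPoint (cone_ofP p) (torus_act_subproof t p).

(* The torus maps the point [pt p] to [pt (torus_act t p)]. *)
Definition torus_invariant_points : set toric_surface :=
  [set x | forall (t : torus) (p : chart_point),
     x = pt p -> pt (torus_act t p) = x].

End ToricSurface.

(* X_P, for an LDP-polygon [P]. *)
Definition toric_del_Pezzo (R : realType) (P : set (R * R)) : Type :=
  toric_surface (spanning_fan P).

(* Main.v *)
(** An automorphism carrying one torus-invariant point to another identifies
    their local rings, hence the orders of their local class groups.  The chart
    of the edge [[a, b]] is the quotient of the plane by the cyclic group of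
    order [r = det(a, b)], and its local class group at the origin is cyclic of
    order [r].  This order is read off from the local ring as follows: all the
    colon ideals (f^k : g^k) are principal if and only if r divides k.  Indeed
    (f : g) is generated in C[x, y] by a semi-invariant, whose r-th power is
    invariant, and conversely the divisor of the ray through [b] has order [r].

    So all the edges have the same determinant r.  For consecutive vertices
    x, v, y one has r (x + y) = det(x, y) v, and v is primitive, so
    x + y = c v with c an integer: all the vertices lie in the lattice N'
    spanned by any edge.  A point of N' in the polygon is 0 or a vertex, so two
    distinct vertices congruent modulo 2N' are opposite, their midpoint not
    being a vertex.  As no vertex lies in 2N', there are at most 3 * 2 of
    them. *)

Require Import Defs.
From HB Require Import structures.
From mathcomp Require Import all_boot all_order all_algebra.
From mathcomp Require Import cyclic separable cyclotomic.
From mathcomp Require Import all_classical all_reals all_analysis.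
From mathcomp Require Import complex.
From mathcomp Require Import ring lra zify.

Set Implicit Arguments.
Unset Strict Implicit.
Unset Printing Implicit Defensive.

Import Order.TTheory GRing.Theory Num.Theory.
Import numFieldNormedType.Exports.

Local Open Scope ring_scope.

(** * Colon ideals of bivariate polynomials and of cyclic invariants *)

(** An automorphism is only known to preserve Zariski open sets and regular functions, so the order
    of the local class group has to be read from germs, with no divisors at hand; this is why it is
    expressed by colon ideals. For k not divisible by r the ideals come from x^p y and x^(rp), with
    p such that both are invariant: in C[x, y] the colon ideal of their k-th powers is generated by
    y^k, and no unit multiple of y^k is invariant. Factoriality of C[x, y] enters only as the
    principality of colon ideals, which Gauss's lemma and pseudo-division give directly. On the
    polygon side no cyclic order of the vertices is set up. Membership in N' is carried from a pair
    of neighbours to the next vertex, and a walk that increases a linear form reaches any given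
    vertex. A nonzero point of N' in the polygon is a vertex because, in an edge cone containing it,
    its coordinates are nonnegative integers of sum at most 1. *)

Definition dvdr (A : comPzRingType) (a b : A) := exists c, b = a * c.

Definition prime_elt (A : comPzRingType) (l : A) :=
  l <> 0 /\ forall a b : A, dvdr l (a * b) -> dvdr l a \/ dvdr l b.

Lemma prime_elt_cancel (A : idomainType) (l a b : A) n :
  prime_elt l -> ~ dvdr l b -> dvdr (l ^+ n) (a * b) -> dvdr (l ^+ n) a.
Proof.
move=> [/eqP l0 lP] nb; elim: n a => [|n IH] a [c abE].
  by exists a; rewrite expr0 mul1r.
have [|[a' aE]|//] := lP a b.
  by exists (l ^+ n * c); rewrite abE exprS mulrA.
have [|d dE] := IH a'; last by exists d; rewrite aE dE exprS mulrA.
by exists c; apply: (mulfI l0); rewrite mulrA -aE abE exprS mulrA.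
Qed.

Lemma size_mul_id (A : idomainType) (p q : {poly A}) :
  p != 0 -> q != 0 -> size (p * q) = size p -> size q = 1%N.
Proof.
move=> p0 q0; rewrite size_mul //.
move: p0 q0; rewrite -!size_poly_gt0; case: (size p) => // m; case: (size q) => // n _ _.
by rewrite addSn addnS /= => /eqP; rewrite eqSS -[X in _ == X]addn0 eqn_add2l => /eqP->.
Qed.

Section Bivariate.
Variable C : numClosedFieldType.
Local Notation B := {poly {poly C}}.
Implicit Types (a b h p q : B).

Definition linx (z : C) : B := ('X - z%:P)%:P.

Lemma dvd_linxP z p : dvdr (linx z) p <-> map_poly (horner_eval z) p = 0.
Proof.
split=> [[q ->]|p0].
  by rewrite rmorphM /= map_polyC /= /horner_eval !hornerE subrr mul0r.
pose f (c : {poly C}) := c %/ ('X - z%:P).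
exists (\poly_(j < size p) f p`_j); apply/polyP => j.
rewrite mul_polyC coefZ coef_poly.
case: ltnP => [_|lej]; last by rewrite mulr0 nth_default.
have : (map_poly (horner_eval z) p)`_j = 0 by rewrite p0 coef0.
rewrite coef_map /= /horner_eval => /eqP; rewrite -/(root _ _) root_factor_theorem.
by move=> /divpK {1}<-; rewrite mulrC.
Qed.

Lemma linx_prime z : prime_elt (linx z).
Proof.
split=> [/eqP|p q /dvd_linxP]; first by rewrite polyC_eq0 polyXsubC_eq0.
rewrite rmorphM => /eqP; rewrite mulf_eq0 => /orP[] /eqP E.
  by left; apply/dvd_linxP.
by right; apply/dvd_linxP.
Qed.

Lemma linx_neq0 z : linx z != 0.
Proof. by apply/eqP; have [] := linx_prime z. Qed.

Lemma lead_coef_linx z p : lead_coef (linx z * p) = ('X - z%:P) * lead_coef p.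
Proof. by rewrite lead_coefM lead_coefC. Qed.

Lemma size_linx z p : size (linx z * p) = size p.
Proof. by rewrite size_Cmul // polyXsubC_eq0. Qed.

Lemma polyX_prime : prime_elt ('X : B).
Proof.
have dvdX p : dvdr 'X p <-> p`_0 = 0.
  split=> [[q ->]|p0]; first by rewrite coefXM.
  have /factor_theorem[q pE] : root p 0 by rewrite rootE horner_coef0 p0.
  by exists q; rewrite pE subr0 mulrC.
split=> [/eqP|p q /dvdX]; first by rewrite polyX_eq0.
by rewrite coef0M => /eqP; rewrite mulf_eq0 => /orP[] /eqP E; [left|right]; apply/dvdX.
Qed.

Lemma size_XsubC_mul z (p : {poly C}) : p != 0 ->
  size (('X - z%:P) * p) = (size p).+1.
Proof. by move=> p0; rewrite size_monicM ?monicXsubC // size_XsubC. Qed.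

Lemma size_lead_linx z p : p != 0 ->
  size (lead_coef (linx z * p)) = (size (lead_coef p)).+1.
Proof. by move=> p0; rewrite lead_coef_linx size_XsubC_mul ?lead_coef_eq0. Qed.

(** Gauss's lemma: as C is closed, [c] is a constant or has a linear factor x - z. Such a factor is
    prime and does not divide [h], so it divides [q] and can be cancelled. *)
Lemma dvd_content (c : {poly C}) h h' q : c != 0 -> c%:P * h' = q * h ->
  (forall z, ~ dvdr (linx z) h) -> dvdr h h'.
Proof.
move=> c0 E nh; elim/ltn_ind: (size c) {-2}c (erefl (size c)) q c0 E => n IH {}c cn q c0 E.
have [/size_poly1P[k k0 ck]|] := boolP (size c == 1%N).
  have K : k%:P%:P * k^-1%:P%:P = 1 :> B by rewrite -!polyCM divff.
  exists (k^-1%:P%:P * q).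
  by rewrite mulrCA [h * q]mulrC -E ck mulrA [_ * k%:P%:P]mulrC K mul1r.
case/closed_rootP => z /factor_theorem[c1 cE].
have c10 : c1 != 0 by apply: contraNneq c0 => c10; rewrite cE c10 mul0r.
have {}E : linx z * (c1%:P * h') = q * h by rewrite -E cE polyCM mulrA [_ * c1%:P]mulrC.
have [_ /(_ q h) []] := linx_prime z.
- by exists (c1%:P * h').
- move=> [q1 q1E]; apply: (IH (size c1) _ c1 erefl q1 c10).
    by rewrite -cn cE mulrC size_XsubC_mul.
  by apply: (mulfI (linx_neq0 z)); rewrite [RHS]mulrA -q1E.
- by move/nh.
Qed.

Definition colon a b h := dvdr a (h * b).

(* Dividing out the linear factors in the inner variable makes [a] primitive;
   then an element of minimal degree generates the colon ideal by
   pseudo-division. *)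
Lemma colon_principal a b : exists2 h0, colon a b h0 &
  forall h, colon a b h -> dvdr h0 h.
Proof.
have [-> |a0] := eqVneq a 0.
  have [-> |b0] := eqVneq b 0.
    by exists 1 => [|h _]; [exists 0; rewrite mulr0 mul0r | exists h; rewrite mul1r].
  exists 0 => [|h [c /eqP]]; first by exists 0; rewrite mulr0 mul0r.
  by rewrite mul0r mulf_eq0 (negPf b0) orbF => /eqP->; exists 0; rewrite mul0r.
(* Removing a factor x - z from [a] lowers the degree in x of its leading coefficient; [b] is
   generalized because it may lose the same factor. *)
elim/ltn_ind: (size (lead_coef a)) {-2}a (erefl (size (lead_coef a))) a0 b
  => n IH {}a an a0 b.
case: (EM (exists z, dvdr (linx z) a)) => [[z [a1 aE]]|na].
  have a10 : a1 != 0 by apply: contraNneq a0 => a10; rewrite aE a10 mulr0.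
  have lt : (size (lead_coef a1) < n)%N by rewrite -an aE size_lead_linx.
  have z0 := linx_neq0 z.
  case: (EM (dvdr (linx z) b)) => [[b1 bE]|nb].
    have [h0 [c hE] hP] := IH _ lt a1 erefl a10 b1.
    exists h0; first by exists c; rewrite aE bE mulrCA hE mulrA.
    move=> h [d dE]; apply: hP; exists d; apply: (mulfI z0).
    by rewrite mulrCA -bE dE aE mulrA.
  have [h0 [c hE] hP] := IH _ lt a1 erefl a10 b.
  exists (linx z * h0); first by exists c; rewrite -[LHS]mulrA hE aE mulrA.
  move=> h [d dE]; have [_ /(_ h b) []//] := linx_prime z.
    by exists (a1 * d); rewrite dE aE mulrA.
  move=> [h1 h1E]; have [|t tE] := hP h1; last by exists t; rewrite h1E tE mulrA.
  by exists d; apply: (mulfI z0); rewrite mulrA -h1E dE aE mulrA.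
pose S s t := exists h, [/\ colon a b h, h != 0, size h = s & size (lead_coef h) = t].
have [s [[t0 st0] smin]] : exists s, (exists t, S s t) /\ forall s' t, S s' t -> (s <= s')%N.
  have : exists s t, S s t by exists (size a), (size (lead_coef a)), a; split=> //; exists b; rewrite mulrC.
  case=> s; elim/ltn_ind: s => s IHs [t Sst].
  case: (EM (exists s' t', S s' t' /\ (s' < s)%N)) => [[s' [t' [S' lt]]]|N].
    by apply: (IHs s' lt); exists t'.
  exists s; split; first by exists t.
  by move=> s' t' S'; rewrite leqNgt; apply/negP => lt; apply: N; exists s', t'.
have [t [Sst tmin]] : exists t, S s t /\ forall t', S s t' -> (t <= t')%N.
  elim/ltn_ind: t0 st0 => t0 IHt st0.
  case: (EM (exists t', S s t' /\ (t' < t0)%N)) => [[t' [S' lt]]|N].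
    exact: (IHt t' lt).
  exists t0; split=> // t' S'; rewrite leqNgt; apply/negP => lt; apply: N; by exists t'.
have [h0 [[c cE] h00 hs ht]] := Sst.
exists h0 => [|h [d dE]]; first by exists c.
have m0 : h %% h0 = 0.
  apply/eqP; apply/negP => /negP m0.
  have := ltn_modpN0 h h00; rewrite hs ltnNge => /negP; apply.
  apply: (smin _ (size (lead_coef (h %% h0)))); exists (h %% h0); split=> //.
  exists (lead_coef h0 ^+ scalp h h0 *: d - h %/ h0 * c).
  have -> : h %% h0 = lead_coef h0 ^+ scalp h h0 *: h - h %/ h0 * h0.
    by rewrite (Pdiv.WeakIdomain.divp_eq h h0) addrC addKr.
  by rewrite mulrBl -scalerAl dE -mulrA cE mulrBr -scalerAr; ring.
have hE := Pdiv.WeakIdomain.divp_eq h h0; rewrite m0 addr0 in hE.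
apply: (dvd_content (c := lead_coef h0 ^+ scalp h h0) (q := h %/ h0)).
- by rewrite expf_neq0 // lead_coef_eq0.
- by rewrite mul_polyC.
(* A factor x - z of [h0] divides [a * c], hence [c], since [a] has no such factor. Cancelling it
   gives an element of the colon ideal with the same degree in y and a smaller leading
   coefficient. *)
move=> z [h1 h1E].
have h10 : h1 != 0 by apply: contraNneq h00 => h10; rewrite h1E h10 mulr0.
have [_ /(_ a c) []] := linx_prime z.
- by exists (h1 * b); rewrite -cE h1E mulrA.
- by move=> za; apply: na; exists z.
move=> [e eE]; have := tmin (size (lead_coef h1)).
rewrite -ht h1E size_lead_linx // ltnn => F; suff : false by []; apply: F.
exists h1; split=> //; last by rewrite -hs h1E size_linx.
exists e; apply: (mulfI (linx_neq0 z)); rewrite mulrA -h1E cE eE; ring.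
Qed.

(** For nonzero [a], write a = h0 d and b = d e. Then (a : b) = (h0 : e), so [h0] divides g as soon
    as it divides g e^j; the factors [h0] are extracted one at a time. *)
Lemma colon_exp a b h0 k : (0 < k)%N -> colon a b h0 ->
  (forall h, colon a b h -> dvdr h0 h) ->
  forall h, colon (a ^+ k) (b ^+ k) h -> dvdr (h0 ^+ k) h.
Proof.
move=> k0 [e eE] hP h [u uE].
have [a0|a0] := eqVneq a 0.
  move/eqP: uE; rewrite a0 expr0n eqn0Ngt k0 mul0r mulf_eq0 expf_eq0 k0 /=.
  case/orP=> /eqP E; first by exists 0; rewrite mulr0.
  have [|v vE] := hP 1; first by exists 0; rewrite E mulr0 mulr0.
  by exists (v ^+ k * h); rewrite mulrA -exprMn -vE expr1n mul1r.
have [|d dE] := hP a; first by exists b.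
have h00 : h0 != 0 by apply: contraNneq a0 => E; rewrite dE E mul0r.
have d0 : d != 0 by apply: contraNneq a0 => E; rewrite dE E mulr0.
have bE : b = d * e by apply: (mulfI h00); rewrite eE dE mulrA.
have step j g v : g * e ^+ j = h0 * v -> dvdr h0 g.
  elim: j v => [|j IH] v gE; first by exists v; rewrite -gE mulr1.
  have [|w wE] := hP (g * e ^+ j); last exact: IH wE.
  by exists v; rewrite bE dE [RHS]mulrAC -gE exprSr; ring.
have {}uE : h * e ^+ k = h0 ^+ k * u.
  by apply: (mulfI (expf_neq0 k d0)); rewrite mulrCA -exprMn -bE uE dE exprMn; ring.
suff H i : forall h u, h * e ^+ k = h0 ^+ i * u -> dvdr (h0 ^+ i) h by exact: H uE.
elim: i {uE} => [|i IH] {}h {}u uE; first by exists h; rewrite mul1r.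
have [h' hE] : dvdr h0 h by apply: (step k h (h0 ^+ i * u)); rewrite uE exprS mulrA.
have [|t tE] := IH h' u; last by exists t; rewrite hE tE exprS mulrA.
by apply: (mulfI h00); rewrite mulrA -hE uE exprS mulrA.
Qed.

Lemma prim_root_exists r : (0 < r)%N -> exists z : C, r.-primitive_root z.
Proof.
move=> r0; pose p : {poly C} := 'X^r - 1.
have [s Ds] := closed_field_poly_normal p.
have Dp : p = \prod_(z <- s) ('X - z%:P).
  by rewrite Ds (monicP _) ?scale1r // monicXnsubC.
have rn1 : all r.-unity_root s by apply/allP=> z; rewrite -root_prod_XsubC -Dp.
have sz_s : (r < (size s).+1)%N by rewrite -(size_prod_XsubC s id) -Dp size_XnsubC.
have us : uniq s.
  rewrite -separable_prod_XsubC -Dp separable_Xn_sub_1 // pnatr_eq0 -lt0n //.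
have [|z] := hasP (has_prim_root r0 rn1 us _) => //.
by exists z.
Qed.

(** * Invariants of the cyclic group of order r acting on the plane with weights s and 1 *)

Section Twist.
Variables (r s : nat) (z : C).
Hypotheses (r0 : (0 < r)%N) (zP : r.-primitive_root z).

Definition scale_inner : {poly C} -> {poly C} := comp_poly ((z ^+ s)%:P * 'X).
Definition twist (p : B) : B :=
  comp_poly (z%:P%:P * 'X) (map_poly scale_inner p).

Fact twist_is_additive : {morph twist : p q / p - q}.
Proof. by move=> p q; rewrite /twist /scale_inner !rmorphB. Qed.
Fact twist_is_monoid : monoid_morphism twist.
Proof. by split=> [|p q]; rewrite /twist /scale_inner ?rmorph1 ?rmorphM. Qed.

HB.instance Definition _ := GRing.isZmodMorphism.Build B B twist twist_is_additive.
HB.instance Definition _ := GRing.isMonoidMorphism.Build B B twist twist_is_monoid.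

Lemma coef_scale (A : comNzRingType) (c : A) (p : {poly A}) n :
  (p \Po (c%:P * 'X))`_n = c ^+ n * p`_n.
Proof.
have -> : p \Po (c%:P * 'X) = \poly_(i < size p) (c ^+ i * p`_i).
  rewrite comp_polyE poly_def; apply: eq_bigr => i _.
  by rewrite mul_polyC exprZn scalerA mulrC.
by rewrite coef_poly; case: ltnP => // /leq_sizeP ->; rewrite ?mulr0.
Qed.

Lemma coef_twist p i j : (twist p)`_j`_i = z ^+ (i * s + j) * p`_j`_i.
Proof.
rewrite coef_scale coef_map /= -polyC_exp coefCM coef_scale mulrA -exprM -exprD.
by rewrite addnC mulnC.
Qed.

Definition invar p := twist p = p.

Lemma invarP p : invar p <-> (forall i j, p`_j`_i != 0 -> (r %| i * s + j)%N).
Proof.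
split=> [pE i j|H]; last first.
  apply/polyP => j; apply/polyP => i; rewrite coef_twist.
  have [-> |/H] := eqVneq p`_j`_i 0; first by rewrite mulr0.
  by rewrite (prim_order_dvd zP) => /eqP->; rewrite mul1r.
have := congr1 (fun p : B => p`_j`_i) pE; rewrite /= coef_twist => /eqP.
rewrite -subr_eq0 -{2}[p`_j`_i]mul1r -mulrBl mulf_eq0 subr_eq0.
by rewrite -(prim_order_dvd zP) => /orP[//|->].
Qed.

Lemma z_neq0 : z != 0.
Proof.
apply/eqP => z0; have := prim_expr_order zP.
by rewrite z0 expr0n eqn0Ngt r0 => /esym/eqP; rewrite oner_eq0.
Qed.

(** [twist] preserves the degree in y and the degree in x of the leading coefficient, so [t] is
    constant; comparing one nonzero coefficient shows that it is a power of [z]. *)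
Lemma twist_dvd h t : h != 0 -> twist h = h * t -> exists2 c : C, c ^+ r = 1 & t = c%:P%:P.
Proof.
move=> h0 E.
have zn n : z ^+ n != 0 by rewrite expf_neq0 // z_neq0.
have szin (c : {poly C}) : size (scale_inner c) = size c.
  by rewrite /scale_inner size_comp_poly2 // size_Cmul // size_polyX.
have inj c : scale_inner c = 0 -> c = 0.
  by move=> c0; apply/eqP; rewrite -size_poly_eq0 -szin c0 size_poly0.
have szt : size (twist h) = size h.
  rewrite /twist size_comp_poly2 ?size_Cmul ?size_polyX ?polyC_eq0 ?z_neq0 //.
  rewrite size_map_inj_poly //; last exact: comp_poly0.
  exact: (@raddf_inj _ _ (comp_poly ((z ^+ s)%:P * 'X)) inj).
have t0 : t != 0.
  by apply: contraNneq h0 => t0; rewrite -size_poly_eq0 -szt E t0 mulr0 size_poly0.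
have /eqP/size_poly1P[d d0 tE] : size t = 1%N.
  by apply: (size_mul_id h0 t0); rewrite -E.
pose l := lead_coef h.
have l0 : l != 0 by rewrite lead_coef_eq0.
have lE : (z ^+ (size h).-1)%:P * scale_inner l = l * d.
  have := congr1 (fun p : B => p`_((size h).-1)) E.
  by rewrite tE /= coefMC coef_scale coef_map /= -lead_coefE /scale_inner => <-; rewrite !polyC_exp.
have /eqP/size_poly1P[c c0 dE] : size d = 1%N.
  by apply: (size_mul_id l0 d0); rewrite -lE size_Cmul // szin.
exists c; last by rewrite tE dE.
have : h`_((size h).-1)`_((size l).-1) != 0 by rewrite -lead_coefE -lead_coefE lead_coef_eq0.
have := congr1 (fun p : B => p`_((size h).-1)`_((size l).-1)) E.
rewrite /= tE dE coefMC coefMC coef_twist mulrC => K nz.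
by rewrite -(mulfI nz K) -exprM mulnC exprM (prim_expr_order zP) expr1n.
Qed.

(* The generator [h0] of the colon ideal of two invariants is semi-invariant,
   hence [h0 ^+ r] is invariant. *)
Lemma invar_colon_exp a b : invar a -> invar b ->
  exists c e, [/\ invar c, invar e, c * b ^+ r = a ^+ r * e &
    forall h u, invar h -> h * b ^+ r = a ^+ r * u ->
      exists2 t, invar t & h = c * t].
Proof.
move=> ai bi; have [h0 [e eE] hP] := colon_principal a b.
have hrP := colon_exp r0 (ex_intro _ e eE) hP.
have [h00|h00] := eqVneq h0 0.
  exists 0, 0; rewrite /invar !rmorph0 mul0r mulr0; split=> // h u hi E.
  have [|t ->] := hrP h; first by exists u.
  by exists 0; rewrite /invar ?rmorph0 // h00 expr0n eqn0Ngt r0 mul0r mulr0.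
(* Since [a] and [b] are invariant, [twist h0] lies in (a : b) too, hence is a multiple of [h0]. *)
have [|t tE] := hP (twist h0).
  by exists (twist e); rewrite -[in LHS]bi -[in RHS]ai -!rmorphM eE.
have [c cr tc] := twist_dvd h00 tE.
have ci : invar (h0 ^+ r).
  by rewrite /invar rmorphXn /= tE tc exprMn -!polyC_exp cr mulr1.
have [e' e'i e'E] : exists2 e', invar e' & h0 ^+ r * b ^+ r = a ^+ r * e'.
  have [a0|a0] := eqVneq a 0.
    exists 0; first by rewrite /invar rmorph0.
    by rewrite -exprMn eE a0 mul0r expr0n eqn0Ngt r0 mulr0.
  exists (e ^+ r); last by rewrite -!exprMn eE.
  have : twist e = t * e.
    apply: (mulfI a0); rewrite -[in LHS]ai -rmorphM -eE rmorphM /= (bi : twist b = b) tE.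
    by rewrite mulrCA -eE; ring.
  by rewrite /invar rmorphXn /= => ->; rewrite tc exprMn -!polyC_exp cr mul1r.
exists (h0 ^+ r), e'; split=> // h u hi hE.
have [|v vE] := hrP h; first by exists u.
exists v => //; apply: (mulfI (expf_neq0 r h00)).
by rewrite -vE -[in LHS]ci -rmorphM -vE; exact: hi.
Qed.

Local Notation X := ('X%:P : B).
Local Notation Y := ('X : B).

Lemma not_dvdX p : p`_0`_0 != 0 -> ~ dvdr X p.
Proof. by move=> p0 [q pE]; move: p0; rewrite pE coefCM coefXM /= eqxx. Qed.

Lemma not_dvdY p : p`_0`_0 != 0 -> ~ dvdr Y p.
Proof. by move=> p0 [q pE]; move: p0; rewrite pE coefXM /= coef0 eqxx. Qed.

Lemma polyCX_prime : prime_elt X.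
Proof. by have := linx_prime 0; rewrite /linx subr0. Qed.

(* The class of the divisor [Y = 0] has order exactly [r] locally at the
   origin. *)
Lemma invar_colon_dvd k m n (c s0 u0 s1 t1 s2 t2 : B) : (k <= n)%N ->
  invar c ->
  s0`_0`_0 != 0 -> s0 * (c * X ^+ m) = Y ^+ k * u0 ->
  s1`_0`_0 != 0 -> s1 * (X ^+ m * Y ^+ k) = c * t1 ->
  s2`_0`_0 != 0 -> s2 * Y ^+ n = c * t2 ->
  (r %| k)%N.
Proof.
move=> kn ci s00 E0 s10 E1 s20 E2.
have X0 : X != 0 by rewrite polyC_eq0 polyX_eq0.
have Y0 : Y != 0 by rewrite polyX_eq0.
have nYX n' : ~ dvdr Y (X ^+ n').
  by move=> [q /(congr1 (fun p : B => p`_0))/eqP]; rewrite coefXM -polyC_exp coefC /= expf_eq0 polyX_eq0 andbF.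
have nXY n' : ~ dvdr X (Y ^+ n').
  move=> [q /(congr1 (fun p : B => p`_n'`_0))/eqP].
  by rewrite coefXn eqxx coefCM coefXM coef1 /= oner_eq0.
(* [s0], [s1] and [s2] have nonzero constant terms: they are units in the local ring at the origin.
   The aim is c = y^k c1 with c1 nonzero at the origin, so that the monomial y^k occurs in the
   invariant [c]. *)
have [c1 cE] : dvdr (Y ^+ k) c.
  have K : dvdr (Y ^+ k) (c * (s0 * X ^+ m)) by exists u0; rewrite -E0; ring.
  apply: prime_elt_cancel K; first exact: polyX_prime.
  by case/(proj2 polyX_prime); [apply: not_dvdY|apply: nYX].
have E1' : t1 * c1 = X ^+ m * s1.
  apply: (mulfI (expf_neq0 k Y0)).
  have -> : Y ^+ k * (t1 * c1) = c * t1 by rewrite cE; ring.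
  by rewrite -E1; ring.
have E2' : s2 * Y ^+ (n - k) = c1 * t2.
  apply: (mulfI (expf_neq0 k Y0)).
  by rewrite [RHS]mulrA -cE -E2 mulrCA -exprD subnKC.
(* Up to a unit [c] divides y^n, so [c1] has no factor x; dividing x^m s1, it then divides [s1]. *)
have nc1 : ~ dvdr X c1.
  move=> [q qE]; have := proj2 polyCX_prime s2 (Y ^+ (n - k)).
  by case; [exists (q * t2); rewrite E2' qE mulrA|exact: not_dvdX|exact: nXY].
have [|v vE] := prime_elt_cancel (n := m) (a := t1) polyCX_prime nc1.
  by exists s1.
have : s1 = c1 * v.
  by apply: (mulfI (expf_neq0 m X0)); rewrite -E1' vE; ring.
move=> s1E; have c10 : c1`_0`_0 != 0.
  by apply: contraNneq s10 => K; rewrite s1E coef0M coef0M K mul0r.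
by have := (invarP c).1 ci 0%N k; rewrite cE coefXnM ltnn subnn mul0n; apply.
Qed.

End Twist.
End Bivariate.

(** * Lattice polygons *)

Lemma seq_argmax d (T : eqType) (F : orderType d) (f : T -> F) (l : seq T) x :
  x \in l -> exists2 y, y \in l & forall u, u \in l -> (f u <= f y)%O.
Proof.
elim: l x => // a l IH x _; case: l IH => [_|b l IH].
  by exists a; rewrite ?mem_head // => u; rewrite inE => /eqP->.
have [y yl yP] := IH b (mem_head _ _).
have [le|lt] := leP (f a) (f y).
  exists y; first by rewrite inE yl orbT.
  by move=> u; rewrite inE => /predU1P[->//|/yP].
exists a; first exact: mem_head.
move=> u; rewrite inE => /predU1P[->//|/yP uy].
exact: le_trans uy (ltW lt).
Qed.

(** In the plane with coordinates (s, t) this is the side of the upper hull which crosses the axis s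
    = 0. [h] is the largest intercept [tau] of a chord crossing the axis, and [c] the largest slope
    from (0, h) to a point on the right. A point on the left above this line would give a chord of
    larger intercept. *)
Lemma supporting_line (F : realFieldType) (T : eqType) (V : seq T) (s t : T -> F) u0 u1 :
  u0 \in V -> s u0 <= 0 -> u1 \in V -> 0 < s u1 ->
  exists x y c h, [/\ x \in V, y \in V, s x <= 0, 0 < s y &
    [/\ t x = h + c * s x, t y = h + c * s y &
    forall u, u \in V -> t u <= h + c * s u]].
Proof.
move=> u0V su0 u1V su1.
pose L := [seq u <- V | s u <= 0]; pose U := [seq u <- V | 0 < s u].
pose tau p := (t p.1 * s p.2 - t p.2 * s p.1) / (s p.2 - s p.1).
have [[x y] /= + maxt] : exists2 p, p \in [seq (x, y) | x <- L, y <- U] &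
    forall q, q \in [seq (x, y) | x <- L, y <- U] -> (tau q <= tau p)%O.
  apply: (@seq_argmax _ _ _ _ _ (u0, u1)); apply: allpairs_f;
  by rewrite mem_filter ?u0V ?u1V ?su0 ?su1.
case/allpairsP => -[x' y'] /= [+ + [? ?]]; subst x' y'.
rewrite !mem_filter => /andP[sx xV] /andP[sy yV].
pose h := tau (x, y).
have hxy : (t x - h) * s y = (t y - h) * s x.
  rewrite /h /tau /=; field; rewrite subr_eq0 gt_eqF //; exact: le_lt_trans sx sy.
have [v] : exists2 v, v \in U & forall u, u \in U -> ((t u - h) / s u <= (t v - h) / s v)%O.
  by apply: (@seq_argmax _ _ _ _ _ y); rewrite mem_filter sy.
rewrite mem_filter => /andP[sv vV] maxv; pose c := (t v - h) / s v.
have vE : t v - h = c * s v by rewrite /c divfK // gt_eqF.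
have up u : u \in V -> 0 < s u -> t u - h <= c * s u.
  by move=> uV su; rewrite -ler_pdivrMr //; apply: maxv; rewrite mem_filter su.
have dn u : u \in V -> s u <= 0 -> t u - h <= c * s u.
  move=> uV su; have : tau (u, v) <= h.
    by apply: maxt; apply: allpairs_f; rewrite mem_filter ?su ?sv.
  rewrite /tau /= ler_pdivrMr; last by lra.
  move=> K; rewrite -(ler_pM2r sv).
  have -> : c * s u * s v = (t v - h) * s u by rewrite vE; ring.
  by lra.
exists x, v, c, h; split=> //; split.
- have := dn x xV sx => K1.
  have K2 : c * s x <= t x - h.
    rewrite -(ler_pM2r sy) hxy mulrAC; apply: ler_wnM2r => //; exact: up.
  by lra.
- by lra.
- by move=> u uV; have [/(dn u uV)|/(up u uV)] := leP (s u) 0; lra.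
Qed.

Definition det (u v : lattice) : int := u.1 * v.2 - u.2 * v.1.

Lemma plucker a b u v :
  det a b * det u v = det u b * det a v - det a u * det v b.
Proof. by rewrite /det; ring. Qed.

Lemma detC u v : det u v = - det v u.
Proof. by rewrite /det; ring. Qed.

Lemma detvv u : det u u = 0.
Proof. by rewrite /det; ring. Qed.

Lemma det_inj a b u v : det a b != 0 ->
  det a u = det a v -> det u b = det v b -> u = v.
Proof.
move=> D0 Ea Eb.
have E1 (x : lattice) : det a b * x.1 = det x b * a.1 + det a x * b.1 by rewrite /det; ring.
have E2 (x : lattice) : det a b * x.2 = det x b * a.2 + det a x * b.2 by rewrite /det; ring.
case: u v Ea Eb (E1 u) (E2 u) (E1 v) (E2 v) => [u1 u2] [v1 v2] /= -> -> Eu1 Eu2 Ev1 Ev2.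
by congr (_, _); apply: (mulfI D0); rewrite ?Eu1 ?Eu2 ?Ev1 ?Ev2.
Qed.

(* An edge from [a] to [b] in counterclockwise order, the supporting line being
   [height a b u = det a b]. *)
Definition height (a b u : lattice) : int := det u b + det a u.

(** [V] may contain repetitions and points that are not vertices. The last clause makes [a] and [b]
    the ends of the whole side: all points of [V] on the line lie between them. *)
Definition edge (V : seq lattice) (a b : lattice) :=
  [/\ a \in V, b \in V, 0 < det a b & forall u, u \in V ->
    height a b u <= det a b /\
    (height a b u = det a b -> 0 <= det a u /\ 0 <= det u b)].

(** Two points on a supporting line are replaced by the extreme points of [V] on it. Heights with
    respect to the two pairs are proportional ([hE]), so the line is unchanged, and the half-open
    cone can only grow. *)
Lemma edge_extend V a b : a \in V -> b \in V -> 0 < det a b ->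
  (forall u, u \in V -> height a b u <= det a b) ->
  exists v1 v2, [/\ edge V v1 v2,
    forall u, u \in V -> height a b u = det a b <-> height v1 v2 u = det v1 v2 &
    forall d, 0 <= det a d -> 0 < det d b -> 0 <= det v1 d /\ 0 < det d v2].
Proof.
move=> aV bV D0 H; pose D := det a b.
pose S := [seq u <- V | height a b u == D].
have aS : a \in S by rewrite mem_filter aV andbT /height detvv addr0.
have bS : b \in S by rewrite mem_filter bV andbT /height detvv add0r.
have [v1 v1S m1] := @seq_argmax _ _ _ (fun u => det u b) S a aS.
have [v2 v2S m2] := @seq_argmax _ _ _ (fun u => det a u) S b bS.
move: v1S v2S; rewrite !mem_filter /height => /andP[/eqP E1 V1] /andP[/eqP E2 V2].
have p1 : D <= det v1 b := m1 a aS.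
have p2 : D <= det a v2 := m2 b bS.
have DD : det v1 v2 = det v1 b + det a v2 - D.
  apply: (mulfI (lt0r_neq0 D0)); rewrite plucker.
  have -> : det a v1 = D - det v1 b by rewrite -E1; ring.
  have -> : det v2 b = D - det a v2 by rewrite -E2; ring.
  by rewrite -/D; ring.
have hE u : D * height v1 v2 u = height a b u * det v1 v2.
  rewrite /height mulrDr (plucker a b u v2) (plucker a b v1 u) DD.
  have -> : det a v1 = D - det v1 b by rewrite -E1; ring.
  have -> : det v2 b = D - det a v2 by rewrite -E2; ring.
  by ring.
have D12 : 0 < det v1 v2 by rewrite DD; move: D0; rewrite -/D; lia.
have iff u : height a b u = D <-> height v1 v2 u = det v1 v2.
  split=> E; first by apply: (mulfI (lt0r_neq0 D0)); rewrite hE E.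
  by apply: (mulIf (lt0r_neq0 D12)); rewrite -hE E.
exists v1, v2; split.
- split=> // u uV; split.
    by rewrite -(ler_pM2l D0) hE ler_pM2r //; apply: H.
  move/iff=> E.
  have uS : u \in S by rewrite mem_filter uV andbT E.
  split; rewrite -(ler_pM2l D0) mulr0 plucker.
    have -> : det a v1 = D - det v1 b by rewrite -E1; ring.
    have -> : det a u = D - det u b by rewrite -E /height; ring.
    have -> : det v1 b * (D - det u b) - (D - det v1 b) * det u b
       = D * (det v1 b - det u b) by ring.
    by apply: mulr_ge0; [exact: ltW|rewrite subr_ge0; exact: m1].
  have -> : det v2 b = D - det a v2 by rewrite -E2; ring.
  have -> : det u b = D - det a u by rewrite -E /height; ring.
  have -> : (D - det a u) * det a v2 - det a u * (D - det a v2)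
       = D * (det a v2 - det a u) by ring.
  by apply: mulr_ge0; [exact: ltW|rewrite subr_ge0; exact: m2].
- by move=> u uV; apply: iff.
move=> d ad db; have q1 : det a v1 <= 0 by move: E1 p1; lia.
have q2 : det v2 b <= 0 by move: E2 p2; lia.
split.
  rewrite -(ler_pM2l D0) mulr0 plucker subr_ge0 (@le_trans _ _ 0) //.
    by apply: mulr_le0_ge0 => //; exact: ltW.
  by apply: mulr_ge0 => //; apply: le_trans p1; exact: ltW.
rewrite -(ltr_pM2l D0) mulr0 plucker subr_gt0 (@le_lt_trans _ _ 0) //.
  exact: mulr_ge0_le0.
by apply: mulr_gt0 => //; apply: lt_le_trans p2.
Qed.

Section Real.
Variables (R : realType) (V : seq lattice).
Hypothesis V_pos : forall w : R * R, w <> 0 ->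
  exists2 u, u \in V & 0 < dot w (lat R u).

(** [supporting_line] is applied with the coordinate [s] across the direction [d] and [t] along it.
    The cone is closed on the side of [v1] only, so that for [d] on the ray of a vertex the edge
    starts there. *)
Lemma edge_at d : d <> 0 -> exists v1 v2, [/\ edge V v1 v2, 0 <= det v1 d & 0 < det d v2].
Proof.
move=> d0; pose s u : R := (det d u)%:~R.
pose t u : R := dot (lat R d) (lat R u).
pose n : R := t d.
have dR : lat R d <> 0.
  by move=> [/eqP]; rewrite intr_eq0 => /eqP E1 /eqP; rewrite intr_eq0 => /eqP E2; apply: d0; case: (d) E1 E2 => a b /= -> ->.
have n0 : 0 < n.
  rewrite /n /t /dot /lat /= lt_neqAle addr_ge0 ?sqr_ge0 // ?andbT -?expr2 ?sqr_ge0 //.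
  apply/eqP => /esym/eqP; rewrite paddr_eq0 ?sqr_ge0 // !sqrf_eq0 => /andP[/eqP E1 /eqP E2].
  by apply: dR; rewrite /lat E1 E2.
have detE u v : n * (det u v)%:~R = t u * s v - s u * t v.
  by rewrite /n /t /s /dot /lat /det /= !(rmorphB, rmorphM) /=; ring.
have rot (e : R) : e != 0 -> exists2 u, u \in V & 0 < e * s u.
  move=> e0; have [|u uV uP] := @V_pos (- e * (lat R d).2, e * (lat R d).1).
    move=> [/eqP E1 /eqP E2]; apply: dR; rewrite [LHS]surjective_pairing.
    move: E1 E2; rewrite !mulf_eq0 oppr_eq0 (negPf e0) /= => /eqP E1 /eqP E2.
    by rewrite /lat E1 E2.
  exists u => //; move: uP; rewrite /dot /s /det /lat /= !(rmorphB, rmorphM) /=.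
  by congr (0 < _); ring.
have [u1 u1V] := rot 1 (oner_neq0 _); rewrite mul1r => su1.
have [|u0 u0V] := rot (-1); first by rewrite oppr_eq0 oner_neq0.
rewrite mulN1r oppr_gt0 => /ltW su0.
have [x [y [c [h [xV yV sx sy [Ex Ey le]]]]]] := supporting_line t u0V su0 u1V su1.
(* The form [w] is t - c s, which is at most [h] on [V]; by [V_pos] it is positive somewhere on
   [V]. *)
have h0 : 0 < h.
  pose w := ((lat R d).1 + c * (lat R d).2, (lat R d).2 - c * (lat R d).1).
  have wE u : dot w (lat R u) = t u - c * s u.
    by rewrite /w /t /s /dot /lat /det /= !(rmorphB, rmorphM) /=; ring.
  have [|u uV] := @V_pos w; last by rewrite wE => K; have := le u uV; lra.
  move=> w0; have : dot w (lat R d) = n.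
    by rewrite wE /s detvv mulr0 subr0.
  by rewrite w0 /dot /= !mul0r addr0 => E; move: n0; rewrite -E ltxx.
have [||v1 [v2 [E12 _ dP]]] := @edge_extend V x y xV yV.
- rewrite -(ltr0z R) -(pmulr_rgt0 _ n0) detE Ex Ey.
  have -> : (h + c * s x) * s y - s x * (h + c * s y) = h * (s y - s x) by ring.
  by rewrite mulr_gt0 // subr_gt0; apply: le_lt_trans sx sy.
- move=> u uV; rewrite -(ler_int R) -(ler_pM2l n0) /height rmorphD mulrDr /= !detE Ex Ey.
  rewrite -subr_ge0.
  have -> : (h + c * s x) * s y - s x * (h + c * s y) -
    (t u * s y - s u * (h + c * s y) + ((h + c * s x) * s u - s x * t u)) =
    (s y - s x) * (h + c * s u - t u) by ring.
  by rewrite mulr_ge0 // subr_ge0; [apply/ltW; apply: le_lt_trans sx sy|apply: le].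
exists v1, v2; have [] := dP d.
- by move: sx; rewrite /s lerz0 detC oppr_le0.
- by move: sy; rewrite /s ltr0z.
by split.
Qed.

End Real.

Definition idot (m u : lattice) : int := m.1 * u.1 + m.2 * u.2.

Lemma dot_lat (R : realType) m u : dot (lat R m) (lat R u) = (idot m u)%:~R.
Proof. by rewrite /dot /lat /idot /= rmorphD !rmorphM. Qed.

Lemma idotDl m n u : idot (m + n) u = idot m u + idot n u.
Proof. by rewrite /idot /=; ring. Qed.

Lemma idotNl m u : idot (- m) u = - idot m u.
Proof. by rewrite /idot /=; ring. Qed.

Lemma idotMnl m k u : idot (m *+ k) u = idot m u *+ k.
Proof.
elim: k => [|k IH]; first by rewrite !mulr0n /idot /= !mul0r addr0.
by rewrite !mulrS idotDl IH.
Qed.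

Definition normal (a b : lattice) : lattice := (b.2 - a.2, a.1 - b.1).

Lemma idot_normal a b u : idot (normal a b) u = height a b u.
Proof. by rewrite /idot /normal /height /det /=; ring. Qed.

Definition swap (u : lattice) : lattice := (u.2, u.1).

Lemma swapK : involutive swap. Proof. by case. Qed.

Lemma det_swap u v : det (swap u) (swap v) = det v u.
Proof. by rewrite /det /swap /=; ring. Qed.

Lemma edge_swap V a b : edge (map swap V) a b -> edge V (swap b) (swap a).
Proof.
case=> aV bV D0 H; have inj := can_inj swapK.
have mem u : (u \in map swap V) = (swap u \in V).
  by rewrite -[u in LHS]swapK mem_map.
rewrite !mem in aV bV; split=> //.
  by rewrite det_swap.
move=> u uV; have [|le eq] := H (swap u); first by rewrite mem swapK.
have hE : height (swap b) (swap a) u = height a b (swap u).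
  by rewrite /height -[u in LHS]swapK !det_swap addrC.
rewrite hE det_swap; split=> // /eq[h1 h2].
by rewrite -[u]swapK !det_swap.
Qed.

Lemma seq_bound (V : seq lattice) (f : lattice -> int) :
  exists2 K, 0 <= K & forall u, u \in V -> `|f u| <= K.
Proof.
elim: V => [|a V [K K0 IH]]; first by exists 0.
exists (K + `|f a|); first by rewrite addr_ge0.
by move=> u; rewrite inE => /predU1P[->|/IH]; rewrite ?lerDr // => /le_trans -> //; rewrite lerDl.
Qed.

Section Exposed.
Variables (R : realType) (V : seq lattice).
Hypothesis V_pos : forall w : R * R, w <> 0 ->
  exists2 u, u \in V & 0 < dot w (lat R u).

(** The reflection [swap] reverses orientation, which moves the closed side of the cone of [edge_at]
    to the second endpoint. *)
Lemma edge_at_left d : d <> 0 ->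
  exists v1 v2, [/\ edge V v1 v2, 0 < det v1 d & 0 <= det d v2].
Proof.
move=> d0.
have pos' w : w <> 0 -> exists2 u, u \in map swap V & 0 < dot w (lat R u).
  move=> w0; have [|u uV uP] := @V_pos (w.2, w.1).
    by move=> E; apply: w0; case: w E => x y [-> ->].
  exists (swap u); first by rewrite map_f.
  by move: uP; rewrite /dot /= addrC.
have [|v1 [v2 [E d1 d2]]] := edge_at pos' (d := swap d).
  by move=> E; apply: d0; case: d E => x y [-> ->].
exists (swap v2), (swap v1); split; first exact: edge_swap.
  by rewrite -[d]swapK det_swap.
by rewrite -[d]swapK det_swap.
Qed.

Definition exposed v := v \in V /\
  exists w : R * R, forall u, u \in V -> u <> v -> dot w (lat R u) < dot w (lat R v).

(** The normal of the edge is tilted: [k] times it minus a form [f] that vanishes at the chosen end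
    and is positive at the other points of [V] on the edge. Heights being integers, k = K + 1 with
    [K] bounding |f| suffices off the edge. *)
Lemma edge_exposed a b : edge V a b -> exposed a /\ exposed b.
Proof.
case=> aV bV D0 H.
have key (f : lattice -> int) (m : lattice) v : v \in V ->
    height a b v = det a b -> (forall u, f u = idot m u) -> f v = 0 ->
    (forall u, u \in V -> height a b u = det a b -> u <> v -> 0 < f u) -> exposed v.
  move=> vV vD fm fv fP; split=> //; have [K K0 KP] := seq_bound V f.
  pose k := K + 1.
  exists (lat R (k * (normal a b).1 - m.1, k * (normal a b).2 - m.2)) => u uV uv.
  rewrite !dot_lat ltr_int.
  have E x : idot (k * (normal a b).1 - m.1, k * (normal a b).2 - m.2) x = k * height a b x - f x.
    by rewrite fm -idot_normal /idot /=; ring.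
  rewrite !E fv vD subr0; have [le _] := H u uV.
  have [e|ne] := eqVneq (height a b u) (det a b).
    by rewrite e ltrBlDr ltrDl fP.
  have lt : height a b u + 1 <= det a b by move: ne le; lia.
  have K1 : - f u <= K by apply: le_trans (KP u uV); rewrite -normrN ler_norm.
  have : k * (height a b u + 1) <= k * det a b by rewrite ler_wpM2l // /k; lia.
  by rewrite mulrDr mulr1 /k; lia.
have nz : det a b != 0 by rewrite gt_eqF.
have zero (u : lattice) f : 0 <= f -> f <> 0 -> 0 < f :> int by lia.
split.
- apply: (key (fun u => det a u) (- a.2, a.1)) => //.
  + by rewrite /height (detvv a) addr0.
  + by move=> u; rewrite /det /idot /=; ring.
  + exact: detvv.
  + move=> u uV uD ua; have [_ /(_ uD) [h1 h2]] := H u uV.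
    apply: zero => // e; apply: ua; apply: (det_inj nz); first by rewrite e detvv.
    by move: uD; rewrite /height e addr0.
- apply: (key (fun u => det u b) (b.2, - b.1)) => //.
  + by rewrite /height (detvv b) add0r.
  + by move=> u; rewrite /det /idot /=; ring.
  + exact: detvv.
  + move=> u uV uD ub; have [_ /(_ uD) [h1 h2]] := H u uV.
    apply: zero => // e; apply: ub; apply: (det_inj nz); last by rewrite e detvv.
    by move: uD; rewrite /height e add0r.
Qed.

Lemma exposed_neq0 v : exposed v -> v <> 0.
Proof.
move=> [_ [w wP]] v0.
have Z x : dot x (lat R 0) = 0 by rewrite /dot /= !mulr0 addr0.
have [w0|/eqP w0] := eqVneq w 0.
  have [|u uV u0] := @V_pos (1, 0); first by case=> /eqP; rewrite oner_eq0.
  have uv : u <> v by move=> E; move: u0; rewrite E v0 Z ltxx.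
  by have := wP u uV uv; rewrite w0 /dot !mul0r ltxx.
have [u uV u0] := V_pos w0.
have [E|/eqP uv] := eqVneq u v; first by move: u0; rewrite E v0 Z ltxx.
by have := wP u uV uv; rewrite v0 Z => /(lt_trans u0); rewrite ltxx.
Qed.

(** Here [v] lies in the triangle 0, [x], [y]. Were it neither [x] nor [y], the form exposing it,
    which is positive at [v], would be smaller at all three corners, hence on the whole triangle. *)
Lemma exposed_corner v x y : exposed v -> x \in V -> y \in V -> 0 < det x y ->
  height x y v <= det x y -> 0 <= det v y -> 0 <= det x v -> v = x \/ v = y.
Proof.
move=> [vV [w wP]] xV yV D0 hv hx hy.
have [->|/eqP vx] := eqVneq v x; first by left.
have [->|/eqP vy] := eqVneq v y; first by right.
exfalso; have ltx := wP x xV (fun e => vx (esym e)).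
have lty := wP y yV (fun e => vy (esym e)).
have w0 : w <> 0 by move=> w0; move: ltx; rewrite w0 /dot !mul0r ltxx.
have [u uV u0] := V_pos w0.
have v0 : 0 < dot w (lat R v).
  have [<- //|/eqP uv] := eqVneq u v.
  exact: lt_trans u0 (wP u uV uv).
have E : (det x y)%:~R * dot w (lat R v) =
   (det v y)%:~R * dot w (lat R x) + (det x v)%:~R * dot w (lat R y).
  by rewrite /dot /lat /det /= !(rmorphB, rmorphM) /=; ring.
move: hv D0 hx hy; rewrite /height -(ler_int R) -!(ler0z R) -(ltr0z R) (intrD R (det v y) (det x v)) => hv D0 hx hy.
set p : R := dot _ _ in E v0 ltx lty; set p1 := dot _ _ in E ltx; set p2 := dot _ _ in E lty.
have : (det v y)%:~R * (p - p1) + (det x v)%:~R * (p - p2) +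
   ((det x y)%:~R - ((det v y)%:~R + (det x v)%:~R)) * p = 0.
  by rewrite mulrBl E; ring.
have A1 : 0 <= (det v y)%:~R * (p - p1) by apply: mulr_ge0; [exact: hx|rewrite subr_ge0; exact: ltW].
have A2 : 0 <= (det x v)%:~R * (p - p2) by apply: mulr_ge0; [exact: hy|rewrite subr_ge0; exact: ltW].
have A3 : 0 <= ((det x y)%:~R - ((det v y)%:~R + (det x v)%:~R)) * p by rewrite mulr_ge0 // ?subr_ge0 // ltW.
move/eqP; rewrite paddr_eq0 ?addr_ge0 // paddr_eq0 // => /andP[/andP[]].
rewrite !mulf_eq0 !subr_eq0 !(gt_eqF ltx, gt_eqF lty, gt_eqF v0) !orbF.
by move=> /eqP e1 /eqP e2; rewrite e1 e2 addr0 gt_eqF.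
Qed.

Lemma exposed_edge v : exposed v -> exists y, edge V v y.
Proof.
move=> ev; have [v1 [v2 [E h1 h2]]] := edge_at V_pos (exposed_neq0 ev).
have [V1 V2 D H] := E; have [le _] := H v ev.1.
have [vE|vE] := exposed_corner ev V1 V2 D le (ltW h2) h1; first by exists v2; rewrite ?vE.
by move: h2; rewrite vE detvv ltxx.
Qed.

Lemma exposed_edge_left v : exposed v -> exists x, edge V x v.
Proof.
move=> ev; have [v1 [v2 [E h1 h2]]] := edge_at_left (exposed_neq0 ev).
have [V1 V2 D H] := E; have [le _] := H v ev.1.
have [vE|vE] := exposed_corner ev V1 V2 D le h2 (ltW h1); last by exists v1; rewrite ?vE.
by move: h1; rewrite vE detvv ltxx.
Qed.

(** * Polygons whose edges all have the same determinant *)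

Section EqualDet.
Variable r : int.
Hypothesis edge_det : forall a b, edge V a b -> det a b = r.
Hypothesis edge_prim : forall a b, edge V a b -> coprimez b.1 b.2.

(** The supporting inequality of each edge at the endpoint of the other one bounds det b b' by 0
    from both sides. *)
Lemma edge_inj v b b' : edge V v b -> edge V v b' -> b = b'.
Proof.
move=> E E'; have [vV bV D0 H] := E; have [_ bV' _ H'] := E'.
have [l _] := H _ bV'; have [l' _] := H' _ bV.
move: l l'; rewrite /height (edge_det E) (edge_det E') => l l'.
apply: (det_inj (lt0r_neq0 D0)); first by rewrite (edge_det E) (edge_det E').
by rewrite detvv; move: l l'; rewrite (detC b b'); lia.
Qed.

(** The identity x + y = c v is stated through integer linear forms because it is applied to
    determinants. The bound on [c] is convexity at [v]: c = 2 would put [x] on the line of the edge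
    from [v] to [y], beyond its end [v]. *)
Lemma consecutive x v y : edge V x v -> edge V v y ->
  exists2 c, c <= 1 & (forall f : lattice -> int, (exists m, forall u, f u = idot m u) ->
     f x + f y = c * f v) .
Proof.
move=> E E'; have Dx := edge_det E; have Dy := edge_det E'.
have r0 : 0 < r by have [_ _ D0 _] := E; rewrite -Dx.
have lin m : r * (idot m x + idot m y) = det x y * idot m v.
  rewrite mulrDr -{1}Dy -Dx /det /idot; ring.
have : (r %| det x y)%Z.
  have d1 : (r %| det x y * v.1)%Z.
    by apply/dvdzP; exists (x.1 + y.1); have := lin (1, 0); rewrite /idot /= !mul1r !mul0r !addr0 mulrC => ->.
  have d2 : (r %| det x y * v.2)%Z.
    by apply/dvdzP; exists (x.2 + y.2); have := lin (0, 1); rewrite /idot /= !mul1r !mul0r !add0r mulrC => ->.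
  have /coprimezP[[p q] /= pq] := edge_prim E.
  have -> : det x y = p * (det x y * v.1) + q * (det x y * v.2).
    by rewrite -[LHS]mul1r -pq; ring.
  by rewrite rpredD // dvdz_mull.
case/dvdzP => c cE; exists c.
  have [_ _ _ H] := E'; have [xV _ _ _] := E; have [le eq] := H x xV.
  move: le eq; rewrite /height Dy (detC v x) Dx cE => le eq.
  have : c * r <> 2 * r.
    by move=> K; case: eq; [rewrite K; ring|lia].
  move=> ne; have : c * r < 2 * r by lia.
  by rewrite ltr_pM2r //; lia.
move=> f [m fm]; rewrite !fm; apply: (mulfI (lt0r_neq0 r0)).
by rewrite lin cE; ring.
Qed.
End EqualDet.
End Exposed.

Lemma count_ltn (T : eqType) (p q : pred T) (l : seq T) u :
  subpred p q -> u \in l -> q u -> ~~ p u -> (count p l < count q l)%N.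
Proof.
move=> pq ul qu pu; have leq s : (count p s <= count q s)%N by apply: sub_count.
elim: l ul => // x l IH; rewrite inE => /predU1P[<-|/IH lt] /=.
  by rewrite qu (negPf pu) add0n add1n ltnS.
by rewrite -addnS leq_add //; case px: (p x) => //; rewrite (pq x px).
Qed.

(** * The lattice spanned by one edge, and the bound of six *)

Section Bound.
Variables (R : realType) (V : seq lattice) (r : int).
Hypothesis V_pos : forall w : R * R, w <> 0 ->
  exists2 u, u \in V & 0 < dot w (lat R u).
Hypothesis edge_det : forall a b, edge V a b -> det a b = r.
Hypothesis edge_prim : forall a b, edge V a b -> coprimez b.1 b.2.
Variables a b : lattice.
Hypothesis ab : edge V a b.

Let r_gt0 : 0 < r.
Proof. by rewrite -(edge_det ab); case: ab. Qed.

Let r_neq0 : r != 0. Proof. by rewrite gt_eqF. Qed.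

(** By Cramer's rule r v = (det v b) a + (det a v) b, so the two divisibilities express membership
    in the lattice spanned by [a] and [b]. *)
Definition in_sublattice v := (r %| det a v)%Z /\ (r %| det v b)%Z.

Lemma det_lin_r u : exists m, forall v, det u v = idot m v.
Proof. by exists (- u.2, u.1) => v; rewrite /det /idot /=; ring. Qed.

Lemma det_lin_l u : exists m, forall v, det v u = idot m v.
Proof. by exists (u.2, - u.1) => v; rewrite /det /idot /=; ring. Qed.

Lemma sublattice_next x v y : edge V x v -> edge V v y ->
  in_sublattice v -> in_sublattice x -> in_sublattice y.
Proof.
move=> E E' [v1 v2] [x1 x2].
have [c _ cP] := consecutive edge_det edge_prim E E'.
have := cP _ (det_lin_r a); have := cP _ (det_lin_l b).
move=> /(canRL (addKr _)) e1 /(canRL (addKr _)) e2.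
by split; rewrite ?e1 ?e2 rpredD ?rpredN ?dvdz_mull.
Qed.

Lemma sublattice_prev x v y : edge V x v -> edge V v y ->
  in_sublattice v -> in_sublattice y -> in_sublattice x.
Proof.
move=> E E' [v1 v2] [x1 x2].
have [c _ cP] := consecutive edge_det edge_prim E E'.
have := cP _ (det_lin_r a); have := cP _ (det_lin_l b).
move=> /(canRL (addrK _)) e1 /(canRL (addrK _)) e2.
by split; rewrite ?e1 ?e2 rpredD ?rpredN ?dvdz_mull.
Qed.

Lemma sublattice_det p q : in_sublattice p -> in_sublattice q -> (r %| det p q)%Z.
Proof.
move=> [/dvdzP[i iE] /dvdzP[j jE]] [/dvdzP[k kE] /dvdzP[l lE]].
apply/dvdzP; exists (j * k - i * l); apply: (mulfI r_neq0).
by rewrite -{1}(edge_det ab) plucker iE jE kE lE; ring.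
Qed.

(** The invariant of the walk. Both neighbours are recorded because x + y = c v propagates
    membership only from two consecutive vertices. *)
Definition good_vertex v := in_sublattice v /\ exists x y,
  [/\ edge V x v, edge V v y, in_sublattice x & in_sublattice y].

Lemma good_vertex_next v y : good_vertex v -> edge V v y -> good_vertex y.
Proof.
move=> [vN [x [_ [E _ xN _]]]] E'; have yN := sublattice_next E E' vN xN.
have [z Ez] := exposed_edge V_pos (edge_exposed R E').2.
split=> //; exists v, z; split=> //; exact: sublattice_next E' Ez yN vN.
Qed.

Lemma good_vertex_prev v x : good_vertex v -> edge V x v -> good_vertex x.
Proof.
move=> [vN [_ [y [_ E _ yN]]]] E'; have xN := sublattice_prev E' E vN yN.
have [z Ez] := exposed_edge_left V_pos (edge_exposed R E').1.
split=> //; exists z, v; split=> //; exact: sublattice_prev Ez E' xN vN.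
Qed.

(** [key] writes u - v as a combination of x - v and y - v; the coefficients are nonnegative because
    [u] is on the inner side of the two edges at [v]. The denominator d = (2 - c) r is positive
    since c <= 1. *)
Lemma local_max (w : R * R) x v y u : edge V x v -> edge V v y -> u \in V ->
  dot w (lat R x) <= dot w (lat R v) -> dot w (lat R y) <= dot w (lat R v) ->
  dot w (lat R u) <= dot w (lat R v).
Proof.
move=> E E' uV lx ly.
have [c c1 cP] := consecutive edge_det edge_prim E E'.
have cE := cP _ (det_lin_r x); rewrite detvv add0r (edge_det E) in cE.
have [_ _ _ /(_ u uV)[l1 _]] := E; have [_ _ _ /(_ u uV)[l2 _]] := E'.
pose d := det x v + det v y - det x y.
have d0 : 0 < (d%:~R : R).
  rewrite ltr0z /d cE (edge_det E) (edge_det E').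
  have -> : r + r - c * r = (2 - c) * r by ring.
  by rewrite mulr_gt0 //; lia.
have key : d%:~R * (dot w (lat R u) - dot w (lat R v)) =
   (det v y - height v y u)%:~R * (dot w (lat R x) - dot w (lat R v)) +
   (det x v - height x v u)%:~R * (dot w (lat R y) - dot w (lat R v)).
  by rewrite /d /dot /lat /height /det /= !(rmorphB, rmorphD, rmorphM) /=; ring.
rewrite -subr_le0 -(pmulr_rle0 _ d0) key.
rewrite -oppr_ge0 opprD addr_ge0 // -mulrN mulr_ge0 ?opprB ?subr_ge0 //.
  by rewrite ler0z subr_ge0.
by rewrite ler0z subr_ge0.
Qed.

(* Walk along the edges, increasing the linear form which exposes [t]. *)
Lemma exposed_sublattice t : exposed R V t -> in_sublattice t.
Proof.
move=> [tV [w wP]].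
(* The induction is on the number of entries of [V] strictly above [v] for [w], which drops at each
   move to a higher neighbour. Without a higher neighbour [v] is a global maximum by [local_max], so
   it is [t]. *)
suff walk n v : (count (fun u => (dot w (lat R v) < dot w (lat R u))%R) V < n)%N ->
    good_vertex v -> in_sublattice t.
  apply: (walk _ a (ltnSn _)).
  have aN : in_sublattice a.
    by split; rewrite ?detvv ?dvdz0 // (edge_det ab).
  have bN : in_sublattice b.
    by split; rewrite ?detvv ?dvdz0 // (edge_det ab).
  have [x Ex] := exposed_edge_left V_pos (edge_exposed R ab).1.
  by split=> //; exists x, b; split=> //; exact: sublattice_prev Ex ab aN bN.
elim: n v => // n IH v; rewrite ltnS => le gv.
have step u : u \in V -> dot w (lat R v) < dot w (lat R u) -> good_vertex u -> in_sublattice t.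
  move=> uV lt; apply: IH; apply: leq_trans le.
  apply: (@count_ltn _ _ _ _ u) => //; last by rewrite ltxx.
  by move=> x; apply: lt_trans.
have [vN [x [y [Ex Ey xN yN]]]] := gv.
have [<- //|/eqP vt] := eqVneq v t.
have ltv := wP v (let: And4 _ h _ _ := Ex in h) vt.
have [lx|lx] := leP (dot w (lat R x)) (dot w (lat R v)); last first.
  by apply: (step x) lx (good_vertex_prev gv Ex); case: Ex.
have [ly|ly] := leP (dot w (lat R y)) (dot w (lat R v)); last first.
  by apply: (step y) ly (good_vertex_next gv Ey); case: Ey.
by have := local_max Ex Ey tV lx ly; rewrite leNgt ltv.
Qed.

(** In the half-open edge cone containing [x], det x v2 is a positive multiple of [r], hence at
    least [r]. The bound on the height then forces det v1 x = 0, and x = v1. *)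
Lemma sublattice_point x : in_sublattice x -> x <> 0 ->
  (forall p q, edge V p q -> height p q x <= r) -> exposed R V x.
Proof.
move=> xN x0 H; have [v1 [v2 [E h1 h2]]] := edge_at V_pos x0.
have [e1 e2] := edge_exposed R E.
have := H _ _ E; rewrite /height.
have /dvdzP[k kE] := sublattice_det xN (exposed_sublattice e2).
rewrite kE in h2 *; have k0 : 0 < k by rewrite -(pmulr_lgt0 _ r_gt0).
have : r <= k * r by rewrite -[X in X <= _]mul1r ler_pM2r //; lia.
move=> l1 l2; have D0 : det v1 v2 != 0 by rewrite (edge_det E).
suff -> : x = v1 by [].
apply: (det_inj D0); first by rewrite detvv; lia.
by rewrite kE (edge_det E); lia.
Qed.

Definition coord1 v := (det v b %/ r)%Z.
Definition coord2 v := (det a v %/ r)%Z.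

Lemma coordE v : in_sublattice v ->
  v = (coord1 v * a.1 + coord2 v * b.1, coord1 v * a.2 + coord2 v * b.2).
Proof.
move=> [d2 d1]; rewrite /coord1 /coord2.
have E1 : r * v.1 = det v b * a.1 + det a v * b.1 by rewrite -(edge_det ab) /det; ring.
have E2 : r * v.2 = det v b * a.2 + det a v * b.2 by rewrite -(edge_det ab) /det; ring.
rewrite [LHS]surjective_pairing; congr (_, _); apply: (mulfI r_neq0).
  by rewrite E1 mulrDr !mulrA ![r * _]mulrC !divzK.
by rewrite E2 mulrDr !mulrA ![r * _]mulrC !divzK.
Qed.

(* Otherwise the midpoint of [v] and [w] would be a nonzero point of the
   sublattice, hence a vertex. *)
Lemma congruent_opposite v w k l : exposed R V v -> exposed R V w -> v <> w ->
  coord1 v + coord1 w = 2 * k -> coord2 v + coord2 w = 2 * l -> w = - v.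
Proof.
move=> ev ew vw kE lE.
have vE := coordE (exposed_sublattice ev); have wE := coordE (exposed_sublattice ew).
pose x : lattice := (k * a.1 + l * b.1, k * a.2 + l * b.2).
have x1 : 2 * x.1 = v.1 + w.1.
  rewrite vE wE /= mulrDr !mulrA -kE -lE; ring.
have x2 : 2 * x.2 = v.2 + w.2.
  rewrite vE wE /= mulrDr !mulrA -kE -lE; ring.
have lin m : 2 * idot m x = idot m v + idot m w.
  by rewrite /idot mulrDr !(mulrCA 2) x1 x2; ring.
have [x0|/eqP x0] := eqVneq x 0.
  rewrite x0 in x1 x2; rewrite [LHS]surjective_pairing [RHS]surjective_pairing /=.
  by congr (_, _); apply/eqP; rewrite -addr_eq0 addrC -?x1 -?x2.
have xN : in_sublattice x.
  split; apply/dvdzP; [exists l|exists k]; rewrite -(edge_det ab) /x /det /=; ring.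
clearbody x.
have ex : exposed R V x.
  apply: sublattice_point => // p q E; have [_ _ _ H] := E.
  have [lv _] := H v ev.1; have [lw _] := H w ew.1; rewrite (edge_det E) in lv lw.
  by have := lin (normal p q); rewrite !idot_normal; lia.
have [_ [f fP]] := ex.
have linf : 2 * dot f (lat R x) = dot f (lat R v) + dot f (lat R w).
  have c1 : 2 * (x.1%:~R : R) = v.1%:~R + w.1%:~R by rewrite -intrD -x1 intrM.
  have c2 : 2 * (x.2%:~R : R) = v.2%:~R + w.2%:~R by rewrite -intrD -x2 intrM.
  by rewrite /dot /lat /= mulrDr !(mulrCA 2) c1 c2; ring.
have neq u u' : u.1 + u'.1 = 2 * x.1 -> u.2 + u'.2 = 2 * x.2 -> u <> u' -> u <> x.
  case: u u' => [u1 u2] [u1' u2'] /= h1 h2 n ux; apply: n.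
  by move: h1 h2; rewrite -ux /= => h1 h2; congr (_, _); lia.
have lv := fP v ev.1 (neq v w (esym x1) (esym x2) vw).
have lw := fP w ew.1 (neq w v _ _ (fun e => vw (esym e))).
have : dot f (lat R v) + dot f (lat R w) < 2 * dot f (lat R x).
  rewrite mulrDl mul1r ltrD // lw //; by rewrite addrC.
by rewrite linf ltxx.
Qed.

(** A half-plane with half of its boundary, containing exactly one of v and -v for nonzero v: it
    tells opposite vertices apart. *)
Definition upper (v : lattice) := (0 < v.1) || (v.1 == 0) && (0 < v.2).

(* The class of [v] modulo twice the sublattice, together with a sign. *)
Definition vertex_code v : nat :=
  upper v + 2 * (~~ odd `|coord1 v| + 2 * (odd `|coord1 v| && odd `|coord2 v|)).

Lemma vertex_code_lt v : (vertex_code v < 6)%N.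
Proof. by rewrite /vertex_code; case: (upper v); case: odd; case: odd. Qed.

Lemma vertex_code_inj v w : exposed R V v -> exposed R V w ->
  vertex_code v = vertex_code w -> v = w.
Proof.
move=> ev ew; have [//|/eqP vw] := eqVneq v w.
(* The code does not distinguish the class (even, even) from (even, odd); the former is excluded
   since vertices are primitive. *)
have odd_or u : exposed R V u -> odd `|coord1 u| || odd `|coord2 u|.
  move=> eu; apply/negPn; rewrite negb_or; apply/negP => /andP[n1 n2].
  have [x E] := exposed_edge_left V_pos eu.
  have := edge_prim E; rewrite (coordE (exposed_sublattice eu)) /=.
  have even (z : int) : ~~ odd `|z| -> exists k, z = k * 2.
    by move=> ?; exists (z %/ 2)%Z; lia.
  have [k ->] := even _ n1; have [l ->] := even _ n2.
  move=> /coprimezP[[p q] /= pq].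
  have : (2%:Z %| 1)%Z.
    apply/dvdzP; exists (p * (k * a.1 + l * b.1) + q * (k * a.2 + l * b.2)).
    apply: etrans (esym pq) _; ring.
  by [].
have := odd_or v ev; have := odd_or w ew.
have opp : upper v = upper w -> odd `|coord1 v| = odd `|coord1 w| ->
    odd `|coord2 v| = odd `|coord2 w| -> False.
  move=> e0 e1 e2.
  have half (x y : int) : odd `|x| = odd `|y| -> exists k, x + y = 2 * k.
    by move=> ?; exists ((x + y) %/ 2)%Z; lia.
  have [k kE] := half _ _ e1; have [l lE] := half _ _ e2.
  have wv := congruent_opposite ev ew vw kE lE.
  have := exposed_neq0 V_pos ev; move: e0; rewrite wv /upper /=.
  case: (v) => x y /= e0 n0; apply: n0; congr (_, _); move: e0; lia.
rewrite /vertex_code.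
case: (upper v) opp; case: (upper w); case: (odd `|coord1 v|);
case: (odd `|coord1 w|); case: (odd `|coord2 v|); case: (odd `|coord2 w|) => //=.
all: by move=> H; case: H.
Qed.

End Bound.

(** * Gluing of charts *)

Local Open Scope classical_set_scope.
Local Open Scope complex_scope.

Section Dual.
Variable R : realType.
Implicit Types sigma tau : set (R * R).

Lemma dotDl (m n : R * R) x : dot (m + n) x = dot m x + dot n x.
Proof. by rewrite /dot /=; ring. Qed.

Lemma latD m n : lat R (m + n) = lat R m + lat R n.
Proof. by rewrite /lat /= !rmorphD. Qed.

Lemma dual_semigroupD sigma m n : dual_semigroup sigma m -> dual_semigroup sigma n ->
  dual_semigroup sigma (m + n).
Proof. by move=> sm sn x sx; rewrite latD dotDl addr_ge0 ?sm ?sn. Qed.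

Lemma dual_semigroup0 sigma : dual_semigroup sigma 0.
Proof. by move=> x _; rewrite /dot /= !mul0r addr0. Qed.

Lemma dual_semigroupMn sigma m k : dual_semigroup sigma m -> dual_semigroup sigma (m *+ k).
Proof.
move=> sm; elim: k => [|k IH]; first by rewrite mulr0n; exact: dual_semigroup0.
by rewrite mulrS; apply: dual_semigroupD.
Qed.

Lemma dual_semigroupS sigma tau m : sigma `<=` tau -> dual_semigroup tau m ->
  dual_semigroup sigma m.
Proof. by move=> st tm x /st /tm. Qed.

Lemma monoid_homMn sigma (g : lattice -> R[i]) m k : monoid_hom sigma g ->
  dual_semigroup sigma m -> g (m *+ k) = g m ^+ k.
Proof.
move=> [g0 gM] sm; elim: k => [|k IH]; first by rewrite mulr0n expr0.
by rewrite mulrS gM ?IH ?exprS //; apply: dual_semigroupMn.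
Qed.

Lemma monoid_homS sigma tau (g : lattice -> R[i]) : sigma `<=` tau ->
  monoid_hom sigma g -> monoid_hom tau g.
Proof.
by move=> st [g0 gM]; split=> // m m' sm sm'; apply: gM; apply: dual_semigroupS st _.
Qed.

(* [g] is the extension of [q] to the localization at [m]. *)
Lemma monoid_hom_localize tau (q : lattice -> R[i]) m : monoid_hom tau q ->
  dual_semigroup tau m -> q m != 0 ->
  exists g : lattice -> R[i],
    (forall n k, dual_semigroup tau (n + m *+ k) -> g n = q (n + m *+ k) / q m ^+ k).
Proof.
move=> qh tm qm; have [q0 qM] := qh.
(* Exponents outside the localization get the dummy value 0; [shift] shows that the chosen [k] does
   not matter. *)
pose g n := match pselect (exists k, dual_semigroup tau (n + m *+ k)) with
  | left e => let k := sval (cid e) in q (n + m *+ k) / q m ^+ k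
  | right _ => 0 end.
exists g => n k nk; rewrite /g; case: pselect => [e|[]]; last by exists k.
case: cid => j nj /=.
have shift i l : dual_semigroup tau (n + m *+ i) ->
    q (n + m *+ (i + l)) / q m ^+ (i + l) = q (n + m *+ i) / q m ^+ i.
  move=> ni; rewrite mulrnDr addrA qM //; last exact: dual_semigroupMn.
  rewrite (monoid_homMn _ qh) // exprD -mulf_div divff ?mulr1 //.
  exact: expf_neq0.
by rewrite -(shift j k) // -(shift k j) // addnC.
Qed.

Lemma localize_hom tau rho (q g : lattice -> R[i]) m : monoid_hom tau q ->
  dual_semigroup tau m -> q m != 0 ->
  (forall n k, dual_semigroup tau (n + m *+ k) -> g n = q (n + m *+ k) / q m ^+ k) ->
  (forall n, dual_semigroup rho n -> exists k, dual_semigroup tau (n + m *+ k)) ->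
  monoid_hom rho g.
Proof.
move=> [q0 qM] tm qm gE rt; split.
  by rewrite (gE 0 0%N) ?mulr0n ?addr0 ?q0 ?expr0 ?divr1 //; exact: dual_semigroup0.
move=> n n' /rt[k nk] /rt[l nl].
have E : n + n' + m *+ (k + l) = (n + m *+ k) + (n' + m *+ l).
  by rewrite mulrnDr addrACA.
rewrite (gE n k) // (gE n' l) // (gE _ (k + l)%N) E; last exact: dual_semigroupD.
by rewrite qM // exprD mulf_div.
Qed.

Definition lmul (f g : laurent R) : laurent R :=
  [seq (a.1 * b.1, a.2 + b.2) | a <- f, b <- g].

Lemma lmul_in sigma f g : in_semigroup_algebra sigma f -> in_semigroup_algebra sigma g ->
  in_semigroup_algebra sigma (lmul f g).
Proof.
move=> sf sg a /allpairsP[[b c] /= [bf cg ->]] /=.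
by apply: dual_semigroupD; [apply: sf|apply: sg].
Qed.

Definition lshift (f : laurent R) (m : lattice) : laurent R := [seq (a.1, a.2 + m) | a <- f].

Definition seval (f : laurent R) (g : lattice -> R[i]) : R[i] := \sum_(a <- f) a.1 * g a.2.

Lemma seval_mul sigma f h g : monoid_hom sigma g -> in_semigroup_algebra sigma f ->
  in_semigroup_algebra sigma h -> seval (lmul f h) g = seval f g * seval h g.
Proof.
move=> [_ gM] sf sh; rewrite /seval /lmul big_allpairs_dep /= big_distrl /=.
apply: eq_big_seq => a af; rewrite big_distrr /=; apply: eq_big_seq => b bh.
rewrite gM; [by rewrite mulrACA|exact: sf|exact: sh].
Qed.

Lemma eq_seval sigma f g g' : in_semigroup_algebra sigma f ->
  (forall m, dual_semigroup sigma m -> g m = g' m) -> seval f g = seval f g'.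
Proof. by move=> sf E; apply: eq_big_seq => a /sf/E ->. Qed.

Section Gluing.
Variable Sigma : set (set (R * R)).
(** The separation lemma of toric geometry: the chart of the intersection is the part of the chart
    of [tau] where the character [m] is invertible. *)
Hypothesis separated : forall sigma tau, Sigma sigma -> Sigma tau ->
  exists m, [/\ dual_semigroup tau m, dual_semigroup sigma (- m) &
    forall n, dual_semigroup (sigma `&` tau) n -> exists k, dual_semigroup tau (n + m *+ k)].

Local Notation chart := (chart_point Sigma).
Implicit Types p q : chart.

Lemma dual_ltail sigma tau m : dual_semigroup sigma m -> dual_semigroup (sigma `&` tau) m.
Proof. exact: dual_semigroupS (@subIsetl _ _ _). Qed.

Lemma dual_rtail sigma tau m : dual_semigroup tau m -> dual_semigroup (sigma `&` tau) m.
Proof. exact: dual_semigroupS (@subIsetr _ _ _). Qed.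

Lemma glued_refl p : glued p p.
Proof.
exists (eval_of p); split=> //; rewrite setIid; exact: eval_ofP.
Qed.

Lemma glued_sym p q : glued p q -> glued q p.
Proof. by move=> [g [gh gp gq]]; exists g; rewrite setIC; split. Qed.

Lemma glued_unit p q m : glued p q -> dual_semigroup (cone_of p) m ->
  dual_semigroup (cone_of q) (- m) -> eval_of p m != 0.
Proof.
move=> [g [[g0 gM] gp gq]] pm qm; rewrite -gp //; apply/eqP => gm0.
have := gM m (- m) (dual_ltail pm) (dual_rtail qm).
by rewrite subrr g0 gm0 mul0r => /eqP; rewrite oner_eq0.
Qed.

(** The characters [m1] and [m2] separating [p] and [r] from [q] are invertible at [q], so [q]
    extends to the localization at m1 + m2. An exponent n of the intersection of the cones of [p]
    and [r] is the sum of n + k m, usable on [r], and of -k m, usable on [p]; adding multiples of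
    [m2] and [m1] brings these into the semigroup of [q]. *)
Lemma glued_trans p q r : glued p q -> glued q r -> glued p r.
Proof.
move=> pq qr.
have [m1 [q1 p1 S1]] := separated (cone_ofP p) (cone_ofP q).
have [m2 [q2 r2 S2]] := separated (cone_ofP r) (cone_ofP q).
have [m [r0 p0 S0]] := separated (cone_ofP p) (cone_ofP r).
have qm1 := glued_unit (glued_sym pq) q1 p1.
have qm2 := glued_unit qr q2 r2.
have [g1 [g1h g1p g1q]] := pq; have [g2 [g2h g2q g2r]] := qr.
pose m' := m1 + m2.
have qm' : dual_semigroup (cone_of q) m' by apply: dual_semigroupD.
have em' : eval_of q m' != 0 by rewrite (proj2 (eval_ofP q)) // mulf_neq0.
have [g gE] := monoid_hom_localize (eval_ofP q) qm' em'.
have ex n : dual_semigroup (cone_of p `&` cone_of r) n ->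
    exists k, dual_semigroup (cone_of q) (n + m' *+ k).
  move=> /S0[k nk].
  have [k2 nk2] := S2 _ (dual_ltail (tau := cone_of q) nk).
  have [k1 nk1] := S1 _ (dual_ltail (tau := cone_of q) (dual_semigroupMn k p0)).
  exists (k1 + k2)%N.
  have -> : n + m' *+ (k1 + k2) = (n + m *+ k + m2 *+ k2) + (- m *+ k + m1 *+ k1)
     + (m1 *+ k2 + m2 *+ k1).
    rewrite /m' mulrnDl !mulrnDr mulNrn [n + _ + _]addrAC -[n + _ + _ + _]addrA addNKr.
    by rewrite -!addrA; congr (n + _); rewrite [RHS]addrC -!addrA.
  apply: dual_semigroupD; first exact: dual_semigroupD.
  by apply: dual_semigroupD; apply: dual_semigroupMn.
have gh := localize_hom (eval_ofP q) qm' em' gE ex.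
exists g; split=> // n.
- move=> pn; have [k nk] := ex n (dual_ltail pn).
  have pn' := dual_ltail (tau := cone_of q) pn.
  have m2' : dual_semigroup (cone_of p `&` cone_of q) m' by exact: dual_rtail.
  rewrite (gE n k nk) -g1q // (proj2 g1h) //; last exact: dual_semigroupMn.
  by rewrite (monoid_homMn _ g1h) // -[eval_of q m']g1q // g1p // mulfK // expf_neq0 // g1q.
- move=> rn; have [k nk] := ex n (dual_rtail rn).
  have rn' := dual_rtail (sigma := cone_of q) rn.
  have m2' : dual_semigroup (cone_of q `&` cone_of r) m' by exact: dual_ltail.
  rewrite (gE n k nk) -g2q // (proj2 g2h) //; last exact: dual_semigroupMn.
  by rewrite (monoid_homMn _ g2h) // -[eval_of q m']g2q // g2r // mulfK // expf_neq0 // g2q.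
Qed.

Lemma pt_eqP p q : pt p = pt q <-> glued p q.
Proof.
split=> [/(congr1 sval) /= E|pq].
  have : [set q' | glued q q'] q by exact: glued_refl.
  by rewrite -E.
apply: eq_exist; apply/seteqP; split=> r /= h; last exact: glued_trans pq h.
exact: glued_trans (glued_sym pq) h.
Qed.

Lemma pt_surj (z : toric_surface Sigma) : exists p, z = pt p.
Proof. by case: z => x [p E]; exists p; apply: eq_exist. Qed.

Lemma same_cone_eval p q : cone_of p = cone_of q -> pt p = pt q ->
  forall m, dual_semigroup (cone_of p) m -> eval_of p m = eval_of q m.
Proof.
by move=> E /pt_eqP[g [_ gp gq]] m pm; rewrite -gp // gq -?E.
Qed.

Definition basic_open sigma (h : laurent R) : set (toric_surface Sigma) :=
  [set z | exists q, [/\ cone_of q = sigma, leval h q != 0 & z = pt q]].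

Lemma uniform_shift tau m (l : seq lattice) : dual_semigroup tau m ->
  (forall n, n \in l -> exists k, dual_semigroup tau (n + m *+ k)) ->
  exists k, forall n, n \in l -> dual_semigroup tau (n + m *+ k).
Proof.
move=> tm; elim: l => [|n l IH] H; first by exists 0%N.
have [|k kP] := IH; first by move=> x xl; apply: H; rewrite inE xl orbT.
have [j jP] := H n (mem_head _ _).
exists (j + k)%N => x; rewrite inE => /predU1P[->|/kP xk].
  by rewrite mulrnDr addrA; apply: dual_semigroupD => //; exact: dual_semigroupMn.
by rewrite addnC mulrnDr addrA; apply: dual_semigroupD => //; exact: dual_semigroupMn.
Qed.

(* Multiplying by a power of the separating character carries Laurent
   polynomials from one chart to another. *)
Lemma chart_transfer q p (fs : seq (laurent R)) : glued q p ->
  (forall f, f \in fs -> in_semigroup_algebra (cone_of q) f) ->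
  exists m, [/\ eval_of p m != 0,
   forall f, f \in fs -> in_semigroup_algebra (cone_of p) (lshift f m) &
   forall p', cone_of p' = cone_of p ->
     (forall f, f \in fs -> eval_of p' m = 0 -> leval (lshift f m) p' = 0) /\
     (eval_of p' m != 0 -> exists q', [/\ cone_of q' = cone_of q, glued q' p' &
       forall f, f \in fs -> leval (lshift f m) p' = leval f q' * eval_of p' m])].
Proof.
move=> qp fsq; have [m [pm qm S]] := separated (cone_ofP q) (cone_ofP p).
have [k kP] : exists k, forall n, n \in flatten [seq [seq a.2 | a : R[i] * lattice <- f] | f <- fs] ->
    dual_semigroup (cone_of p) (n + m *+ k).
  apply: uniform_shift => // n /flattenP[e /mapP[f ff ->] /mapP[a af ->]].
  by apply: S; apply: dual_ltail; apply: (fsq f).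
have {}kP f a : f \in fs -> a \in f -> dual_semigroup (cone_of p) (a.2 + m *+ k).
  move=> ff af; apply: kP; apply/flattenP; exists [seq b.2 | b : R[i] * lattice <- f].
    by apply/mapP; exists f.
  by apply/mapP; exists a.
(* [k] shifts already bring all exponents into the semigroup; one more makes the shifted functions
   vanish wherever the character does. *)
exists (m *+ k.+1); split.
- rewrite (monoid_homMn _ (eval_ofP p)) // expf_neq0 //.
  exact: glued_unit (glued_sym qp) pm qm.
- move=> f ff _ /mapP[a af ->] /=; rewrite mulrSr addrA.
  by apply: dual_semigroupD => //; apply: kP ff af.
move=> p' cp'; rewrite -cp' in pm kP S.
have Em := monoid_homMn k.+1 (eval_ofP p') pm.
split=> [f ff|].
  rewrite Em => /eqP; rewrite expf_eq0 /= => /eqP m0.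
  rewrite /leval big_map big_seq big1 // => a af /=.
  by rewrite mulrSr addrA (proj2 (eval_ofP p')) // ?m0 ?mulr0 //; apply: kP ff af.
rewrite Em expf_eq0 /= => m0.
have [g gE] := monoid_hom_localize (eval_ofP p') pm m0.
have gh := localize_hom (eval_ofP p') pm m0 gE S.
have gq : monoid_hom (cone_of q) g by apply: monoid_homS gh; exact: subIsetl.
exists (ChartPoint (cone_ofP q) gq); split=> //.
  exists g; split=> //= n pn.
  by rewrite (gE n 0%N) ?mulr0n ?addr0 ?expr0 ?divr1.
move=> f ff; rewrite /leval big_map big_distrl /= big_seq [RHS]big_seq.
apply: eq_bigr => a af.
have ak : dual_semigroup (cone_of p') (a.2 + m *+ k.+1).
  by rewrite mulrSr addrA; apply: dual_semigroupD => //; apply: kP ff af.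
by rewrite (gE a.2 k.+1) // -mulrA divfK // expf_neq0.
Qed.

Lemma eq_leval sigma f p q : in_semigroup_algebra sigma f -> cone_of p = sigma ->
  cone_of q = sigma -> pt p = pt q -> leval f p = leval f q.
Proof.
by move=> sf cp cq E; apply: (eq_seval sf) => m sm; apply: same_cone_eval; rewrite ?cp ?cq.
Qed.

Lemma basic_open_open sigma h : in_semigroup_algebra sigma h ->
  zariski_open (basic_open sigma h).
Proof.
move=> sh p [q [cq hq /esym/pt_eqP qp]].
have hin f : f \in [:: h] -> in_semigroup_algebra (cone_of q) f.
  by rewrite inE cq => /eqP->.
have [m [pm hm H]] := chart_transfer qp hin.
have hh := mem_head h [::]; exists (lshift h m); split; first exact: hm.
  have [_ /(_ pm)[q' [cq' q'p E]]] := H p erefl.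
  rewrite E // mulf_neq0 // (@eq_leval sigma h q' q) ?cq' //.
  by apply/pt_eqP; apply: glued_trans q'p (glued_sym qp).
move=> p' cp'; have [Z /[swap]] := H p' cp'.
have [/Z -> //|m0] := eqVneq (eval_of p' m) 0; first by rewrite eqxx.
move=> nz /(_ isT)[q' [cq' q'p E]]; exists q'; split; first by rewrite cq'.
  by move: nz; rewrite E // mulf_eq0 negb_or => /andP[].
by apply/pt_eqP/glued_sym.
Qed.

(** [chart_transfer] carries numerator and denominator to any other chart with the same shift [m],
    which cancels in the quotient. *)
Lemma fraction_regular sigma g h : in_semigroup_algebra sigma g ->
  in_semigroup_algebra sigma h -> exists2 f, regular_on (basic_open sigma h) f &
    forall q, cone_of q = sigma -> leval h q != 0 -> f (pt q) = leval g q / leval h q.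
Proof.
move=> sg sh.
pose f z := match pselect (basic_open sigma h z) with
  | left e => let q := sval (cid e) in leval g q / leval h q
  | right _ => 0 end.
have fE q : cone_of q = sigma -> leval h q != 0 -> f (pt q) = leval g q / leval h q.
  move=> cq hq; rewrite /f; case: pselect => [e|[]]; last by exists q.
  case: cid => q' [cq' _ E] /=.
  by rewrite (@eq_leval sigma g q q') // (@eq_leval sigma h q q').
exists f => // p [q [cq hq /esym/pt_eqP qp]].
have hin l : l \in [:: g; h] -> in_semigroup_algebra (cone_of q) l.
  by rewrite !inE cq => /orP[] /eqP->.
have [m [pm hm H]] := chart_transfer qp hin.
have gg : g \in [:: g; h] by rewrite inE eqxx.
have hh : h \in [:: g; h] by rewrite !inE eqxx orbT.
exists (lshift g m), (lshift h m); split; [exact: hm|exact: hm| |].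
  have [_ /(_ pm)[q' [cq' q'p E]]] := H p erefl.
  rewrite E // mulf_neq0 // (@eq_leval sigma h q' q) ?cq' //.
  by apply/pt_eqP; apply: glued_trans q'p (glued_sym qp).
move=> p' cp' _; have [Z /[swap]] := H p' cp'.
have [/Z -> //|m0] := eqVneq (eval_of p' m) 0; first by rewrite eqxx.
move=> nz /(_ isT)[q' [cq' q'p E]].
have -> : pt p' = pt q' by apply/pt_eqP/glued_sym.
have hq' : leval h q' != 0 by move: nz; rewrite E // mulf_eq0 negb_or => /andP[].
by rewrite fE ?cq' // !E // -mulf_div divff // mulr1.
Qed.

(** Numerator and denominator are multiplied by the equation [h1] of a basic neighbourhood inside
    [V]: then a nonzero denominator alone puts the point in [V]. *)
Lemma regular_fraction sigma V f p : zariski_open V -> regular_on V f -> V (pt p) ->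
  cone_of p = sigma -> exists g h, [/\ in_semigroup_algebra sigma g,
    in_semigroup_algebra sigma h, leval h p != 0 &
    forall q, cone_of q = sigma -> leval h q != 0 ->
      V (pt q) /\ f (pt q) = leval g q / leval h q].
Proof.
move=> Vo fr Vp <-; have [h1 [sh1 h1p H1]] := Vo p Vp.
have [g [h [sg sh hp H]]] := fr p Vp.
have E l1 l2 q : cone_of q = cone_of p -> in_semigroup_algebra (cone_of p) l1 ->
   in_semigroup_algebra (cone_of p) l2 -> leval (lmul l1 l2) q = leval l1 q * leval l2 q.
  by move=> cq s1 s2; apply: (seval_mul (eval_ofP q)); rewrite cq.
exists (lmul g h1), (lmul h h1); split; try exact: lmul_in.
  by rewrite E // mulf_neq0.
move=> q cq; rewrite !E // mulf_eq0 negb_or => /andP[hq h1q].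
have Vq : V (pt q) by exact: H1.
by split=> //; rewrite H // -mulf_div divff // mulr1.
Qed.

End Gluing.
End Dual.

(** * The spanning fan *)

Section Polygon.
Variable R : realType.
Implicit Types (w x : R * R) (V : seq lattice).

Lemma dotDr w x y : dot w (x + y) = dot w x + dot w y.
Proof. by rewrite /dot /=; ring. Qed.

Lemma dotZr w a x : dot w (a *: x) = a * dot w x.
Proof. by rewrite /dot /= /GRing.scale /=; ring. Qed.

Lemma dot_sum w V (c : lattice -> R) :
  dot w (\sum_(v <- V) c v *: lat R v) = \sum_(v <- V) c v * dot w (lat R v).
Proof.
elim: V => [|v V IH]; first by rewrite !big_nil /dot /= !mulr0 addr0.
by rewrite !big_cons dotDr dotZr IH.
Qed.

Lemma mem_hull V u : u \in V -> convex_hull (R:=R) V (lat R u).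
Proof.
(* [V] may repeat [u], so the total weight 1 is shared among its [n] occurrences. *)
move=> uV; pose n : R := (count_mem u V)%:R.
have n0 : n != 0 by rewrite pnatr_eq0 -lt0n -has_count has_pred1.
have key (A : lmodType R) (f : lattice -> A) : \sum_(v <- V) (if v == u then n^-1 else 0) *: f v = f u.
  rewrite (bigID (pred1 u)) /= [X in _ + X]big1 ?addr0; last first.
    by move=> v /negPf ->; rewrite scale0r.
  rewrite (eq_bigr (fun=> n^-1 *: f u)); last by move=> v /eqP ->; rewrite eqxx.
  by rewrite big_const_seq iter_addr_0 -scaler_nat scalerA divff // scale1r.
exists (fun v => if v == u then n^-1 else 0); split.
- by move=> v; case: ifP => // _; rewrite invr_ge0 ler0n.
- rewrite -[RHS](key R^o (fun=> 1)); apply: eq_bigr => v _.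
  by rewrite /GRing.scale /= mulr1.
- by rewrite key.
Qed.

Lemma hull_le V w h x : (forall u, u \in V -> dot w (lat R u) <= h) ->
  convex_hull V x -> dot w x <= h.
Proof.
move=> H [c [c0 c1 ->]]; rewrite dot_sum -[h]mul1r -c1 mulr_suml.
by rewrite big_seq [leRHS]big_seq ler_sum // => v vV; rewrite ler_wpM2l // H.
Qed.

Lemma hull_eq V w h x : (forall u, u \in V -> dot w (lat R u) <= h) ->
  convex_hull V x -> dot w x = h -> exists c : lattice -> R,
   [/\ forall v, 0 <= c v, \sum_(v <- V) c v = 1,
     x = \sum_(v <- V) c v *: lat R v &
     forall u, u \in V -> c u = 0 \/ dot w (lat R u) = h].
Proof.
move=> H [c [c0 c1 xE]] xh; exists c; split=> // u uV.
have : \sum_(v <- V | v \in V) c v * (h - dot w (lat R v)) == 0.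
  rewrite -big_seq; under eq_bigr do rewrite mulrBr.
  by rewrite sumrB -mulr_suml c1 mul1r -dot_sum -xE xh subrr.
rewrite psumr_eq0; last by move=> v vV; rewrite mulr_ge0 // subr_ge0 H.
move=> /allP/(_ u uV); rewrite uV /= mulf_eq0 subr_eq0 => /orP[/eqP|/eqP/esym]; by [left|right].
Qed.

(** A small positive multiple of [w] lies in the hull, and the form [w] is positive there. *)
Lemma interior_pos V w : interior (convex_hull V) (0 : R * R) -> w <> 0 ->
  exists2 u, u \in V & 0 < dot w (lat R u).
Proof.
move=> /nbhs_ballP[e /= e0 eP] w0.
have nw : 0 < `|w| by rewrite normr_gt0; apply/eqP.
pose t := e / (2 * `|w|).
have t0 : 0 < t by rewrite divr_gt0 // mulr_gt0.
have Pt : convex_hull V (t *: w).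
  apply: eP; rewrite -ball_normE /ball_ /= sub0r normrN normrZ gtr0_norm // /t.
  by rewrite invfM mulrA divfK ?gt_eqF // ltr_pdivrMr // ltr_pMr // ltr1n.
have ww : 0 < dot w w.
  rewrite lt_neqAle /dot addr_ge0 ?andbT -?expr2 ?sqr_ge0 //.
  apply/eqP => /esym/eqP; rewrite paddr_eq0 ?sqr_ge0 // !sqrf_eq0 => /andP[/eqP E1 /eqP E2].
  by apply: w0; rewrite [LHS]surjective_pairing E1 E2.
apply: contrapT => N.
have : dot w (t *: w) <= 0.
  apply: hull_le Pt => u uV; rewrite leNgt; apply/negP => K; apply: N; by exists u.
by rewrite dotZr leNgt mulr_gt0.
Qed.

Lemma exposed_vertex V v : exposed R V v -> is_vertex (convex_hull V) (lat R v).
Proof.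
move=> [vV [w wP]]; exists w, (dot w (lat R v)).
have le u : u \in V -> dot w (lat R u) <= dot w (lat R v).
  by move=> uV; have [-> //|/eqP uv] := eqVneq u v; apply/ltW/wP.
split; first by move=> x; apply: hull_le.
apply/seteqP; split=> x /=; first by move=> ->; split=> //; exact: mem_hull.
move=> [Px xE]; have [c [c0 c1 -> cP]] := hull_eq le Px xE.
rewrite (eq_big_seq (fun u => c u *: lat R v)); first by rewrite -scaler_suml c1 scale1r.
move=> u uV; have [-> |E] := cP u uV; first by rewrite !scale0r.
have [-> //|/eqP uv] := eqVneq u v.
by have := wP u uV uv; rewrite E ltxx.
Qed.

Lemma lat_inj : injective (lat R).
Proof. by move=> [a b] [c d] [/eqP + /eqP]; rewrite !eqr_int => /eqP-> /eqP->. Qed.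

Lemma primitive_coprime v : primitive R v -> coprimez v.1 v.2.
Proof.
move=> [v0 H]; pose g := gcdz v.1 v.2.
have g0 : g != 0.
  by rewrite gcdz_eq0; apply/negP => /andP[/eqP e1 /eqP e2]; apply: v0; rewrite [LHS]surjective_pairing e1 e2.
have gp : 0 < g by rewrite lt_neqAle eq_sym g0.
pose u : lattice := ((v.1 %/ g)%Z, (v.2 %/ g)%Z).
have u1 : v.1 = u.1 * g by rewrite divzK // dvdz_gcdl.
have u2 : v.2 = u.2 * g by rewrite divzK // dvdz_gcdr.
have gR : (g%:~R : R) != 0 by rewrite intr_eq0.
have [|||E] := H u (g%:~R)^-1.
- rewrite invr_ge0 ler0z ltW //= invf_le1 ?ltr0z //.
  by rewrite (_ : 1 = 1%:~R) // ler_int -gtz0_ge1.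
- by rewrite /lat u1 u2 !rmorphM /=; congr (_, _); rewrite /GRing.scale /= mulrC mulfK.
- by move=> E; case: v0; rewrite [LHS]surjective_pairing u1 u2 E /= !mul0r.
have : g = 1.
  apply: contrapT => g1; apply: v0.
  have z (a b : int) : a = b * g -> b = a -> a = 0.
    move=> h1 h2; move: h1; rewrite h2 => /eqP; rewrite -[X in X == _]mulr1 -subr_eq0 -mulrBr.
    by rewrite mulf_eq0 subr_eq0 => /orP[/eqP//|/eqP/esym].
  by rewrite [LHS]surjective_pairing (z _ _ u1 (congr1 fst E)) (z _ _ u2 (congr1 snd E)).
by move=> g1; rewrite /coprimez -/g g1.
Qed.

Section Fan.
Variable V : seq lattice.
Hypothesis V_pos : forall w : R * R, w <> 0 ->
  exists2 u, u \in V & 0 < dot w (lat R u).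
Local Notation P := (convex_hull (R:=R) V).

(* The integer form [m] supports the face spanning [sigma] at height [h]; the
   value [h > 0] normalizes the forms of all the faces consistently. *)
Definition supports (sigma : set (R * R)) m h :=
  [/\ 0 < h, forall u, u \in V -> idot m u <= h,
      forall u, u \in V -> idot m u = h -> sigma (lat R u) &
      forall n, dual_semigroup sigma n <->
        forall u, u \in V -> idot m u = h -> 0 <= idot n u].

Lemma supportsI F w c m h :
  (forall x, P x -> dot w x <= c) -> F = [set x | P x /\ dot w x = c] ->
  0 < h -> (forall u, u \in V -> idot m u <= h) ->
  (forall u, u \in V -> dot w (lat R u) = c <-> idot m u = h) ->
  supports (cone_over F) m h.
Proof.
move=> le FE h0 mh E.
have mem u : u \in V -> idot m u = h -> cone_over F (lat R u).
  move=> uV /(E u uV) uc; right; exists 1, (lat R u); rewrite scale1r; split=> //.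
  by rewrite FE; split=> //; exact: mem_hull.
split=> // n; split=> [nF u uV um|H x].
  by have := nF _ (mem u uV um); rewrite dot_lat ler0z.
case=> [->|[t [y [t0 Fy ->]]]]; first by rewrite /dot /= !mulr0 addr0.
rewrite dotZr mulr_ge0 //.
move: Fy; rewrite FE => -[Py yc].
have [|d [d0 d1 -> dP]] := hull_eq _ Py yc.
  by move=> u uV; apply: le; exact: mem_hull.
rewrite dot_sum big_seq sumr_ge0 // => u uV.
have [->|/(E u uV) um] := dP u uV; first by rewrite mul0r.
by rewrite mulr_ge0 // dot_lat ler0z H.
Qed.

Lemma edge_supports a b : edge V a b ->
  exists2 sigma, spanning_fan P sigma & supports sigma (normal a b) (det a b).
Proof.
move=> [aV bV D0 H]; pose w := lat R (normal a b); pose c : R := (det a b)%:~R.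
pose F := [set x | P x /\ dot w x = c].
have le x : P x -> dot w x <= c.
  by apply: hull_le => u uV; rewrite dot_lat ler_int idot_normal; have [] := H u uV.
exists (cone_over F).
  exists F; split=> //; first by exists w, c.
  move=> FP; have [u uV u0] : exists2 u, u \in V & 0 < dot (- w) (lat R u).
    apply: V_pos => w0; have := dot_lat R (normal a b) a.
    rewrite -/w -[w]opprK w0 idot_normal /height detvv addr0 /dot /= oppr0 !mul0r addr0.
    by move=> /esym/eqP; rewrite intr_eq0 gt_eqF.
  have : F (lat R u) by rewrite FP; exact: mem_hull.
  case=> _ E; have wN : dot (- w) (lat R u) = - c by rewrite -E /dot /=; ring.
  by move: u0; rewrite wN oppr_gt0 ltrz0 ltNge ltW.
apply: (supportsI le) => // u uV; first by rewrite idot_normal; have [] := H u uV.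
rewrite dot_lat idot_normal /c; split=> [/eqP|->//].
by rewrite eqr_int => /eqP.
Qed.

(** The real form that defines the face may be irrational. An integral one selecting the same points
    of [V] is found according to whether the face contains none of them, two independent ones, or a
    single one. *)
Lemma fan_supports sigma : spanning_fan P sigma -> exists m h, supports sigma m h.
Proof.
move=> [F [[w [c [le FE]]] FP ->]].
have leV u : u \in V -> dot w (lat R u) <= c by move=> uV; apply: le; exact: mem_hull.
have [[v vV vc]|N] := pselect (exists2 v, v \in V & dot w (lat R v) = c); last first.
  (* The zero form never reaches height 1, which matches the empty face and the chart of the
     torus. *)
  exists 0, 1; apply: (supportsI le FE) => // u uV; first by rewrite /idot /= !mul0r addr0.
  split=> [E|]; first by case: N; exists u.
  by rewrite /idot /= !mul0r addr0.
have w0 : w <> 0.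
  move=> w0; apply: FP; rewrite FE; apply/seteqP; split=> x /=; first by case.
  by move=> Px; split=> //; rewrite -vc w0 /dot /= !mul0r.
have c0 : 0 < c by have [u uV u0] := V_pos w0; apply: lt_le_trans u0 (leV u uV).
have [[u1 [u2 [u1V u2V D0 [u1c u2c]]]]|N] := pselect (exists u1 u2,
   [/\ u1 \in V, u2 \in V, 0 < det u1 u2 &
    dot w (lat R u1) = c /\ dot w (lat R u2) = c]).
  have D0' : (0 : R) < (det u1 u2)%:~R by rewrite ltr0z.
  have E u : (det u1 u2)%:~R * dot w (lat R u) = c * (idot (normal u1 u2) u)%:~R.
    rewrite idot_normal /height intrD [RHS]mulrDr -{1}u1c -u2c.
    by rewrite /dot /lat /det /= !(rmorphB, rmorphM) /=; ring.
  exists (normal u1 u2), (det u1 u2); apply: (supportsI le FE) => // u uV.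
    by rewrite -(ler_int R) -(ler_pM2l c0) -E mulrC ler_pM2r // leV.
  split=> [uc|um].
    apply/eqP; rewrite -(eqr_int R); apply/eqP; apply: (mulfI (lt0r_neq0 c0)).
    by rewrite -E uc mulrC.
  by apply: (mulfI (lt0r_neq0 D0')); rewrite E um mulrC.
(* Without two independent points, all points of [V] on the face are parallel, and being at the same
   height c > 0 they coincide. *)
have uniq u : u \in V -> dot w (lat R u) = c -> u = v.
  move=> uV uc; have D : det v u = 0.
    apply/eqP; rewrite eq_le !leNgt; apply/andP; split; apply/negP => D0; apply: N.
      by exists v, u.
    by exists u, v; split=> //; rewrite detC oppr_gt0.
  have D1 : (det v u)%:~R = 0 :> R by rewrite D.
  apply: lat_inj; rewrite [LHS]surjective_pairing [RHS]surjective_pairing.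
  congr (_, _); apply: (mulfI (lt0r_neq0 c0)); rewrite -[in LHS]vc -[in RHS]uc.
    have : dot w (lat R v) * (lat R u).1 - dot w (lat R u) * (lat R v).1 = w.2 * - (det v u)%:~R.
      by rewrite /dot /lat /det /= !(rmorphB, rmorphM) /=; ring.
    by rewrite D1 oppr0 mulr0 => /eqP; rewrite subr_eq0 => /eqP.
  have : dot w (lat R v) * (lat R u).2 - dot w (lat R u) * (lat R v).2 = w.1 * (det v u)%:~R.
    by rewrite /dot /lat /det /= !(rmorphB, rmorphM) /=; ring.
  by rewrite D1 mulr0 => /eqP; rewrite subr_eq0 => /eqP.
have ev : exposed R V v.
  split=> //; exists w => u uV uv; rewrite vc lt_neqAle leV // andbT.
  by apply/eqP => uc; apply: uv; exact: uniq.
have [y [_ yV Dy Hy]] := exposed_edge V_pos ev.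
have [x [xV _ Dx Hx]] := exposed_edge_left V_pos ev.
(* The sum of the normals of the two edges at [v] is maximal exactly where both are, that is at
   [v]. *)
exists (normal x v + normal v y), (det x v + det v y).
have iE u : idot (normal x v + normal v y) u = height x v u + height v y u.
  by rewrite -!idot_normal /idot /=; ring.
apply: (supportsI le FE) => [||u uV]; first exact: addr_gt0.
  by move=> u uV; rewrite iE; apply: lerD; [have [] := Hx u uV|have [] := Hy u uV].
have vE : height x v v + height v y v = det x v + det v y.
  by rewrite /height !detvv add0r addr0.
split=> [/(uniq u uV) ->|um]; first by rewrite iE vE.
suff -> : u = v by [].
have [hx ex] := Hx u uV; have [hy ey] := Hy u uV; rewrite iE in um.
have hxE : height x v u = det x v by lia.
have hyE : height v y u = det v y by lia.
have [_ uv] := ex hxE; have [vu _] := ey hyE.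
have uv0 : det u v = 0 by apply/eqP; rewrite eq_le uv andbT detC oppr_le0.
apply: (det_inj (lt0r_neq0 Dx)); last by rewrite uv0 detvv.
by move: hxE; rewrite /height uv0 add0r.
Qed.

(** [m] is mt / ht - ms / hs cleared of denominators: it is nonnegative on the points of [V]
    selected by [mt], nonpositive on those selected by [ms]. On the former it vanishes only at the
    common points and, being integral, is at least 1 elsewhere; hence a bound on [n] gives the
    exponent. *)
Lemma fan_separated sigma tau : spanning_fan P sigma -> spanning_fan P tau ->
  exists m, [/\ dual_semigroup tau m, dual_semigroup sigma (- m) &
    forall n, dual_semigroup (sigma `&` tau) n -> exists k, dual_semigroup tau (n + m *+ k)].
Proof.
move=> /fan_supports[ms [hs [hs0 les ins ds]]] /fan_supports[mt [ht [ht0 let_ int_ dt]]].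
pose m : lattice := (hs * mt.1 - ht * ms.1, hs * mt.2 - ht * ms.2).
have mE u : idot m u = hs * idot mt u - ht * idot ms u by rewrite /idot /m /=; ring.
exists m; split.
- apply/dt => u uV E; rewrite mE E mulrC -mulrBr mulr_ge0 ?subr_ge0 ?les //; exact: ltW.
- apply/ds => u uV E; rewrite idotNl mE E opprB mulrC -mulrBr mulr_ge0 ?subr_ge0 ?let_ //; exact: ltW.
move=> n nst; have [K K0 KP] := seq_bound V (fun u => idot n u).
exists `|K|%N; apply/dt => u uV E; rewrite idotDl idotMnl.
have mu : idot m u = ht * (hs - idot ms u) by rewrite mE E; ring.
have [e|ne] := eqVneq (idot ms u) hs.
  rewrite mu e subrr mulr0 mul0rn addr0 -(ler0z R) -dot_lat.
  by apply: nst; split; [exact: ins|exact: int_].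
have m1 : 1 <= idot m u.
  by rewrite mu -gtz0_ge1 mulr_gt0 // subr_gt0 lt_neqAle ne les.
have : 1 *+ `|K|%N <= idot m u *+ `|K|%N by rewrite lerMn2r m1 orbT.
have : - idot n u <= K by apply: le_trans (KP u uV); rewrite -normrN ler_norm.
by move: K0; rewrite -mulr_natr mul1r; lia.
Qed.

(** If the points of [V] on the face were all parallel, a nonzero form vanishing on them would lie
    in the dual together with its opposite. *)
Lemma full_cone_edge sigma : spanning_fan P sigma ->
  (forall m, dual_semigroup sigma m -> dual_semigroup sigma (- m) -> m = 0) ->
  exists a b, edge V a b /\ supports sigma (normal a b) (det a b).
Proof.
move=> /fan_supports[m [h [h0 le mem dual]]] full.
have [[u1 [u2 [[u1V u2V] D0 u1h u2h]]]|N] := pselect (exists u1 u2,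
   [/\ u1 \in V /\ u2 \in V, 0 < det u1 u2, idot m u1 = h & idot m u2 = h]).
  have E u : h * height u1 u2 u = det u1 u2 * idot m u.
    by rewrite /height mulrDr -{1}u1h -u2h /det /idot; ring.
  have [|v1 [v2 [Ev iff _]]] := @edge_extend V u1 u2 u1V u2V D0.
    by move=> u uV; rewrite -(ler_pM2l h0) E mulrC ler_pM2r // le.
  have iff' u : u \in V -> idot (normal v1 v2) u = det v1 v2 <-> idot m u = h.
    move=> uV; rewrite idot_normal -(iff u uV); split=> K.
      by apply: (mulfI (lt0r_neq0 D0)); rewrite -E K mulrC.
    by apply: (mulfI (lt0r_neq0 h0)); rewrite E K mulrC.
  exists v1, v2; split=> //; have [_ _ D12 H] := Ev; split=> //.
  - by move=> u uV; rewrite idot_normal; have [] := H u uV.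
  - by move=> u uV /(iff' u uV); apply: mem.
  move=> n; split=> [/dual K u uV /(iff' u uV)|K]; first exact: K.
  by apply/dual => u uV um; apply: K => //; apply/(iff' u uV).
have par u1 u2 : u1 \in V -> u2 \in V -> idot m u1 = h -> idot m u2 = h -> det u1 u2 = 0.
  move=> U1 U2 h1 h2; apply/eqP; rewrite eq_le !leNgt; apply/andP; split; apply/negP => D0.
    by apply: N; exists u1, u2.
  by apply: N; exists u2, u1; split=> //; rewrite detC oppr_gt0.
have [[u0 u0V um]|N'] := pselect (exists2 u, u \in V & idot m u = h); last first.
  have E : ((1, 0) : lattice) = 0.
    by apply: full; apply/dual => u uV um; case: N'; exists u.
  by case: E.
have z u : u \in V -> idot m u = h -> idot (- u0.2, u0.1) u = 0.
  by move=> uV uh; rewrite -(par u0 u) // /idot /det /=; ring.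
have E : ((- u0.2, u0.1) : lattice) = 0.
  apply: full; apply/dual => u uV uh; first by rewrite z.
  by rewrite idotNl z // oppr0.
case: E => /eqP; rewrite oppr_eq0 => /eqP e2 e1.
by move: um h0; rewrite /idot e1 e2 !mulr0 addr0 => <-; rewrite ltxx.
Qed.

Lemma edge_dual sigma a b n : edge V a b -> supports sigma (normal a b) (det a b) ->
  dual_semigroup sigma n <-> 0 <= idot n a /\ 0 <= idot n b.
Proof.
move=> [aV bV D0 H] [_ _ _ dual]; split=> [/dual K|[na nb]].
  by split; apply: K => //; rewrite idot_normal /height detvv ?addr0 ?add0r.
apply/dual => u uV; rewrite idot_normal => /(proj2 (H u uV))[h1 h2].
rewrite -(ler_pM2l D0) mulr0.
have -> : det a b * idot n u = det u b * idot n a + det a u * idot n b.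
  by rewrite /det /idot; ring.
by rewrite addr_ge0 // mulr_ge0.
Qed.

End Fan.
End Polygon.

(** * Local class groups *)

Section PolyFun.
Variable C : numClosedFieldType.

Lemma poly_fun_eq0 (p : {poly C}) : (forall x, p.[x] = 0) -> p = 0.
Proof.
move=> H; apply/eqP; apply: contraT => p0.
pose l : seq C := [seq i%:R | i <- iota 0 (size p)].
have : (size l < size p)%N.
  apply: max_poly_roots p0 _ _; first by apply/allP => x _; rewrite rootE H.
  by rewrite map_inj_uniq ?iota_uniq // => i j /eqP; rewrite eqr_nat => /eqP.
by rewrite size_map size_iota ltnn.
Qed.

Lemma poly2_fun_eq0 (H : {poly {poly C}}) :
  (forall x y, H.[y%:P].[x] = 0) -> H = 0.
Proof.
move=> HE; apply/polyP => j; rewrite coef0; apply: poly_fun_eq0 => x.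
have : map_poly (horner_eval x) H = 0.
  apply: poly_fun_eq0 => y; have := HE x y; rewrite -[H.[_].[x]]/(horner_eval x _).
  by rewrite -horner_map /= /horner_eval hornerC.
by move/(congr1 (fun p : {poly C} => p`_j)); rewrite coef_map coef0.
Qed.

End PolyFun.

Section StalkProperty.
Variables (R : realType) (Sigma : set (set (R * R))).
Local Notation X := (toric_surface Sigma).

(* In the stalk at [z], every colon ideal (a^k : b^k) is principal. *)
Definition colon_principal_at (k : nat) (z : X) :=
  forall (V : set X) (a b : X -> R[i]), zariski_open V -> V z ->
    regular_on V a -> regular_on V b ->
  exists (W : set X) (c u : X -> R[i]), [/\ zariski_open W, W z, regular_on W c /\ regular_on W u,
    forall x, W x -> c x * b x ^+ k = a x ^+ k * u x &
    forall (W' : set X) (h u' : X -> R[i]), zariski_open W' -> W' z ->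
      regular_on W' h -> regular_on W' u' ->
      (forall x, W' x -> h x * b x ^+ k = a x ^+ k * u' x) ->
    exists (W'' : set X) (t : X -> R[i]), [/\ zariski_open W'', W'' z, regular_on W'' t &
      forall x, W'' x -> h x = c x * t x]].

(** The property involves only open sets and regular functions: the data are composed with the
    inverse [psi], and the resulting generator and quotient with [phi]. *)
Lemma automorphism_colon phi k x : is_automorphism phi ->
  colon_principal_at k (phi x) -> colon_principal_at k x.
Proof.
move=> [phiM [psi [psiM phiK psiK]]] H V a b Vo Vx ar br.
have [Vo' Vr] := psiM V Vo.
have [|W [c [u [Wo Wx [cr ur] E P]]]] := H _ (a \o psi) (b \o psi) Vo' _ (Vr _ ar) (Vr _ br).
  by rewrite /preimage /= phiK.
have [Wo' Wr] := phiM W Wo.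
exists (phi @^-1` W), (c \o phi), (u \o phi); split=> //.
- by split; exact: Wr.
- by move=> y /E; rewrite /= !phiK.
move=> W' h u' W'o W'x hr u'r E'.
have [W'o' W'r] := psiM W' W'o.
have [||W'' [t [W''o W''x tr E'']]] := P _ (h \o psi) (u' \o psi) W'o' _ (W'r _ hr) (W'r _ u'r).
- by rewrite /preimage /= phiK.
- by move=> y W'y; exact: E'.
have [W''o' W''r] := phiM W'' W''o.
exists (phi @^-1` W''), (t \o phi); split=> //; first exact: W''r.
by move=> y /E''; rewrite /= phiK.
Qed.

Lemma regular_onS (V W : set X) f : V `<=` W -> regular_on W f -> regular_on V f.
Proof.
move=> VW fr p /VW /fr[g [h [sg sh hp H]]]; exists g, h; split=> // q cq /VW; exact: H.
Qed.

(** * The chart of an edge as the quotient of the plane by a cyclic group *)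

Section Chart.
Hypothesis separated : forall sigma tau, Sigma sigma -> Sigma tau ->
  exists m, [/\ dual_semigroup tau m, dual_semigroup sigma (- m) &
    forall n, dual_semigroup (sigma `&` tau) n -> exists k, dual_semigroup tau (n + m *+ k)].
Variables (sigma : set (R * R)) (v1 v2 : lattice) (r s : nat) (z : R[i]).
Hypotheses (Ssigma : Sigma sigma) (r_gt0 : (0 < r)%N) (zP : r.-primitive_root z).
Hypothesis dualE : forall n, dual_semigroup sigma n <-> 0 <= idot n v1 /\ 0 <= idot n v2.
Hypothesis idot_inj : forall m m', idot m v1 = idot m' v1 -> idot m v2 = idot m' v2 -> m = m'.
Hypothesis imageE : forall i j : nat,
  (exists m, idot m v1 = i%:Z /\ idot m v2 = j%:Z) <-> (r %| i * s + j)%N.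

Local Notation B := {poly {poly R[i]}}.
Local Notation inv := (@invar R[i] s z).
Local Notation chart := (chart_point Sigma).

Definition deg1 m := `|idot m v1|%N.
Definition deg2 m := `|idot m v2|%N.

Lemma degE m : dual_semigroup sigma m -> idot m v1 = (deg1 m)%:Z /\ idot m v2 = (deg2 m)%:Z.
Proof. by move=> /dualE[h1 h2]; rewrite /deg1 /deg2 !gez0_abs. Qed.

Lemma degD m n : dual_semigroup sigma m -> dual_semigroup sigma n ->
  deg1 (m + n) = (deg1 m + deg1 n)%N /\ deg2 (m + n) = (deg2 m + deg2 n)%N.
Proof.
move=> sm sn; have [a1 a2] := degE sm; have [b1 b2] := degE sn.
have [c1 c2] := degE (dual_semigroupD sm sn).
by move: c1 c2; rewrite !idotDl a1 a2 b1 b2 -!PoszD => -[->] [->].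
Qed.

Lemma deg_inj m n : dual_semigroup sigma m -> dual_semigroup sigma n ->
  deg1 m = deg1 n -> deg2 m = deg2 n -> m = n.
Proof.
move=> sm sn e1 e2; have [a1 a2] := degE sm; have [b1 b2] := degE sn.
by apply: idot_inj; rewrite ?a1 ?a2 ?b1 ?b2 ?e1 ?e2.
Qed.

Lemma deg_dvd m : dual_semigroup sigma m -> (r %| deg1 m * s + deg2 m)%N.
Proof. by move=> sm; apply/imageE; exists m; exact: degE. Qed.

Definition mono (i j : nat) : B := ('X^i)%:P * 'X^j.

Lemma coef_mono i j k l : (mono i j)`_l`_k = ((k == i) && (l == j))%:R.
Proof. by rewrite coefCM coefXn mulr_natr coefMn coefXn; case: (l == j); rewrite ?andbT ?andbF. Qed.

Lemma monoD i j k l : mono i j * mono k l = mono (i + k) (j + l).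
Proof. by rewrite /mono mulrACA -polyCM -!exprD. Qed.

(** The identification of C[S_sigma] with the invariants in C[x, y], the exponents of x and y being
    the pairings with the two rays; [imageE] says which monomials occur, and [laurent_of] goes
    back. *)
Definition poly_of (f : laurent R) : B :=
  \sum_(a <- f) a.1%:P%:P * mono (deg1 a.2) (deg2 a.2).

Lemma invar_const (c : R[i]) : inv c%:P%:P.
Proof.
by rewrite /invar /twist map_polyC /= /scale_inner !comp_polyC.
Qed.

Lemma invar_mono i j : (r %| i * s + j)%N -> inv (mono i j).
Proof.
move=> d; apply/(invarP _ zP) => k l; rewrite coef_mono.
by case: andP => [[/eqP-> /eqP->]|_]; rewrite ?eqxx.
Qed.

Lemma invarM (p q : B) : inv p -> inv q -> inv (p * q).
Proof. by rewrite /invar rmorphM /= => -> ->. Qed.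

Lemma invarX (p : B) n : inv p -> inv (p ^+ n).
Proof. by rewrite /invar rmorphXn /= => ->. Qed.

Lemma invar1 : inv 1.
Proof. by rewrite /invar rmorph1. Qed.

Lemma invar_poly_of f : in_semigroup_algebra sigma f -> inv (poly_of f).
Proof.
move=> sf; rewrite /invar /poly_of rmorph_sum /=; apply: eq_big_seq => a /sf sa.
by apply: invarM; [exact: invar_const|exact: invar_mono (deg_dvd sa)].
Qed.

Lemma poly_of_mul f g : in_semigroup_algebra sigma f -> in_semigroup_algebra sigma g ->
  poly_of (lmul f g) = poly_of f * poly_of g.
Proof.
move=> sf sg; rewrite /poly_of /lmul big_allpairs_dep /= big_distrl /=.
apply: eq_big_seq => a /sf sa; rewrite big_distrr /=; apply: eq_big_seq => b /sg sb.
by have [-> ->] := degD sa sb; rewrite -monoD !polyCM mulrACA.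
Qed.

Lemma coef_poly_of f m : in_semigroup_algebra sigma f -> dual_semigroup sigma m ->
  (poly_of f)`_(deg2 m)`_(deg1 m) = \sum_(a <- f | a.2 == m) a.1.
Proof.
move=> sf sm; rewrite /poly_of coef_sum coef_sum [RHS]big_mkcond /=; apply: eq_big_seq => a /sf sa.
rewrite coefCM coefCM coef_mono; case: (a.2 =P m) => [->|ne]; first by rewrite !eqxx mulr1.
case: andP => [[/eqP e1 /eqP e2]|_]; last by rewrite mulr0.
by case: ne; apply: deg_inj => //.
Qed.

(** The list may repeat exponents: its terms are grouped by exponent, and the sum of each group is a
    coefficient of [poly_of f]. *)
Lemma leval_eq0 f (q : chart) : in_semigroup_algebra sigma f ->
  poly_of f = 0 -> leval f q = 0.
Proof.
move=> sf f0; rewrite /leval.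
rewrite (eq_big_seq (fun a : R[i] * lattice =>
   \sum_(m <- undup [seq b.2 | b : R[i] * lattice <- f] | a.2 == m) a.1 * eval_of q m)).
  rewrite (exchange_big_dep predT) //= big_seq big1 // => m.
  rewrite mem_undup => /mapP[b /sf sb ->]; rewrite -mulr_suml.
  by rewrite -coef_poly_of // f0 !coef0 mul0r.
move=> a af; rewrite (eq_bigl (pred1 a.2)); last by move=> m; rewrite eq_sym.
rewrite -big_filter filter_pred1_uniq ?undup_uniq ?big_seq1 //.
by rewrite mem_undup; apply/mapP; exists a.
Qed.

Lemma leval_eq f g (q : chart) : in_semigroup_algebra sigma f -> in_semigroup_algebra sigma g ->
  poly_of f = poly_of g -> leval f q = leval g q.
Proof.
move=> sf sg E; pose g' : laurent R := [seq (- a.1, a.2) | a <- g].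
have sg' : in_semigroup_algebra sigma (f ++ g').
  by move=> a; rewrite mem_cat => /orP[/sf//|/mapP[b /sg sb ->]].
have g'E : leval g' q = - leval g q.
  by rewrite /leval big_map -sumrN; apply: eq_bigr => a _; rewrite mulNr.
apply/eqP; rewrite -subr_eq0 -g'E /leval -big_cat /=; apply/eqP/(leval_eq0 q sg').
rewrite /poly_of big_cat /= big_map -/(poly_of f) E -[X in _ + X]opprK -sumrN.
apply/eqP; rewrite subr_eq0; apply/eqP; apply: eq_bigr => a _.
by rewrite !polyCN mulNr opprK.
Qed.

(** For a pair that is not attained the value is a dummy 0; in an invariant polynomial such a pair
    has coefficient zero. *)
Definition expt (i j : nat) : lattice :=
  match pselect (exists m, idot m v1 = i%:Z /\ idot m v2 = j%:Z) with
  | left e => sval (cid e)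
  | right _ => 0 end.

Lemma expt_dual i j : dual_semigroup sigma (expt i j).
Proof.
rewrite /expt; case: pselect => [e|_]; last exact: dual_semigroup0.
by case: cid => m [h1 h2] /=; apply/dualE; rewrite h1 h2.
Qed.

Lemma expt_deg i j : (r %| i * s + j)%N -> deg1 (expt i j) = i /\ deg2 (expt i j) = j.
Proof.
move/imageE => e; rewrite /expt; case: pselect => // e'.
by case: cid => m [h1 h2] /=; rewrite /deg1 /deg2 h1 h2.
Qed.

Definition laurent_of (H : B) : laurent R :=
  [seq (H`_j`_i, expt i j) | j <- iota 0 (size H), i <- iota 0 (size H`_j)].

Lemma laurent_of_in H : in_semigroup_algebra sigma (laurent_of H).
Proof. by move=> a /allpairsPdep[j [i [_ _ ->]]]; exact: expt_dual. Qed.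

Lemma laurent_ofK H : inv H -> poly_of (laurent_of H) = H.
Proof.
move=> Hi; rewrite /poly_of /laurent_of big_allpairs_dep /=.
rewrite -[RHS]coefK poly_def -(big_mkord xpredT (fun j => H`_j *: 'X^j)) /index_iota subn0.
apply: eq_big_seq => j _.
rewrite -[in RHS](coefK H`_j) poly_def -mul_polyC rmorph_sum mulr_suml /=.
rewrite -(big_mkord xpredT (fun i => (H`_j`_i *: 'X^i)%:P * 'X^j)) /index_iota subn0.
apply: eq_big_seq => i _; rewrite -mul_polyC polyCM -mulrA.
have [-> |nz] := eqVneq H`_j`_i 0; first by rewrite !mul0r.
by have [-> ->] := expt_deg ((invarP s zP H).1 Hi i j nz).
Qed.

Definition cval (H : B) (q : chart) := leval (laurent_of H) q.

Lemma cval_poly_of f q : in_semigroup_algebra sigma f -> cone_of q = sigma ->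
  cval (poly_of f) q = leval f q.
Proof.
move=> sf cq; apply: leval_eq => //; first exact: laurent_of_in.
by rewrite laurent_ofK //; exact: invar_poly_of.
Qed.

Lemma cvalM G H q : inv G -> inv H -> cone_of q = sigma ->
  cval (G * H) q = cval G q * cval H q.
Proof.
move=> Gi Hi cq; have sG := @laurent_of_in G; have sH := @laurent_of_in H.
rewrite -[in LHS](laurent_ofK Gi) -[in LHS](laurent_ofK Hi) -poly_of_mul //.
rewrite cval_poly_of //; last exact: lmul_in.
by apply: (seval_mul (eval_ofP q)); rewrite cq.
Qed.

Lemma cval1 q : cone_of q = sigma -> cval 1 q = 1.
Proof.
move=> cq; pose f : laurent R := [:: (1, 0)].
have f1 : poly_of f = 1.
  by rewrite /poly_of big_seq1 /deg1 /deg2 /idot /= !mul0r addr0 /mono !expr0 !mulr1.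
rewrite -f1 cval_poly_of //; last by move=> a; rewrite inE => /eqP->; exact: dual_semigroup0.
by rewrite /leval big_seq1 /= (proj1 (eval_ofP q)) mulr1.
Qed.

Lemma cvalX H n q : inv H -> cone_of q = sigma -> cval (H ^+ n) q = cval H q ^+ n.
Proof.
move=> Hi cq; elim: n => [|n IH]; first by rewrite !expr0 cval1.
by rewrite !exprS cvalM ?IH //; exact: invarX.
Qed.

Lemma plane_subproof (x y : R[i]) :
  monoid_hom sigma (fun m => x ^+ deg1 m * y ^+ deg2 m).
Proof.
split=> [|m n sm sn]; first by rewrite /deg1 /deg2 /idot /= !mul0r addr0 !expr0 mulr1.
by have [-> ->] := degD sm sn; rewrite !exprD mulrACA.
Qed.

(* The quotient map from the affine plane onto the chart of [sigma]. *)
Definition plane (x y : R[i]) : chart := ChartPoint Ssigma (plane_subproof x y).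

Lemma leval_plane f x y : leval f (plane x y) = (poly_of f).[y%:P].[x].
Proof.
rewrite /leval /poly_of !horner_sum; apply: eq_bigr => a _.
by rewrite hornerCM hornerCM /mono hornerCM hornerXn -polyC_exp hornerM hornerXn hornerC.
Qed.

Lemma cval_plane H x y : inv H -> cval H (plane x y) = H.[y%:P].[x].
Proof. by move=> Hi; rewrite /cval leval_plane laurent_ofK. Qed.

Lemma cval_origin H : inv H -> cval H (plane 0 0) = H`_0`_0.
Proof. by move=> Hi; rewrite cval_plane // polyC0 !horner_coef0. Qed.

#[local] Hint Resolve invarM invarX invar1 : core.

(** Multiplying by [H] removes the exceptional locus. The points of [plane] then suffice, a
    polynomial vanishing on all of C^2 being zero. *)
Lemma cval_identity E F H : inv E -> inv F -> inv H -> H != 0 ->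
  (forall q, cone_of q = sigma -> cval H q != 0 -> cval E q = cval F q) -> E = F.
Proof.
move=> Ei Fi Hi H0 K; apply: (mulIf H0); apply/eqP; rewrite -subr_eq0; apply/eqP.
apply: poly2_fun_eq0 => x y; rewrite !hornerD !hornerN -!cval_plane; auto.
rewrite !cvalM //; have [-> |nz] := eqVneq (cval H (plane x y)) 0; first by rewrite !mulr0 subrr.
by rewrite K // subrr.
Qed.

Definition dopen (H : B) : set X := basic_open sigma (laurent_of H).

Lemma dopen_open H : zariski_open (dopen H).
Proof. by apply: basic_open_open => //; exact: laurent_of_in. Qed.

Local Notation origin := (pt (plane 0 0)).

Lemma dopen_origin H : inv H -> H`_0`_0 != 0 -> dopen H origin.
Proof. by move=> Hi H0; exists (plane 0 0); split=> //; rewrite -[leval _ _]/(cval _ _) cval_origin. Qed.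

Lemma dopen_fraction G H : inv G -> inv H -> exists2 f, regular_on (dopen H) f &
  forall q, cone_of q = sigma -> cval H q != 0 -> f (pt q) = cval G q / cval H q.
Proof.
move=> Gi Hi; apply: (fraction_regular separated); exact: laurent_of_in.
Qed.

Lemma fraction_at_origin V f : zariski_open V -> V origin -> regular_on V f ->
  exists G H, [/\ inv G, inv H, H`_0`_0 != 0 &
    forall q, cone_of q = sigma -> cval H q != 0 -> V (pt q) /\ f (pt q) = cval G q / cval H q].
Proof.
move=> Vo Vz fr; have [g [h [sg sh h0 P]]] := regular_fraction Vo fr Vz erefl.
exists (poly_of g), (poly_of h); split; try exact: invar_poly_of.
  by rewrite -cval_origin ?cval_poly_of //; exact: invar_poly_of.
by move=> q cq; rewrite !cval_poly_of //; exact: P.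
Qed.

Lemma coef00M (p q : B) : (p * q)`_0`_0 = p`_0`_0 * q`_0`_0.
Proof. by rewrite !coef0M. Qed.

Lemma coef00X (p : B) n : (p ^+ n)`_0`_0 = p`_0`_0 ^+ n.
Proof. by elim: n => [|n IH]; rewrite ?coef1 //= !exprS coef00M IH. Qed.

Lemma colon_principal_origin : colon_principal_at r origin.
Proof.
move=> V a b Vo Vz ar br.
have [A [A' [Ai A'i A0 aP]]] := fraction_at_origin Vo Vz ar.
have [Bb [B' [Bi B'i B0 bP]]] := fraction_at_origin Vo Vz br.
have [c0 [e0 [ci ei E0 H0]]] := invar_colon_exp r_gt0 zP Ai Bi.
have Ari := invarX r A'i; have Bri := invarX r B'i.
have [c cr cP] := dopen_fraction ci invar1.
(* With a = A / A' and b = Bb / B', the relation c b^r = a^r u holds for c = c0 and u = e0 A'^r /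
   B'^r. *)
have [u ur uP] := dopen_fraction (invarM ei Ari) Bri.
have AB := invarM A'i B'i.
have nzAB q : cone_of q = sigma -> cval (A' * B') q != 0 -> cval A' q != 0 /\ cval B' q != 0.
  by move=> cq; rewrite cvalM // mulf_eq0 negb_or => /andP[].
have cP' q : cone_of q = sigma -> c (pt q) = cval c0 q.
  by move=> cq; rewrite cP // cval1 ?divr1 ?oner_neq0.
exists (dopen (A' * B')), c, u; split.
- exact: dopen_open.
- by apply: dopen_origin => //; rewrite coef00M mulf_neq0.
- split.
    apply: regular_onS cr => x [q [cq _ ->]]; exists q; split=> //.
    by rewrite -[leval _ _]/(cval _ _) cval1 // oner_neq0.
  apply: regular_onS ur => x [q [cq /(nzAB q cq)[_ nB] ->]]; exists q; split=> //.
  by rewrite -[leval _ _]/(cval _ _) cvalX // expf_neq0.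
- move=> x [q [cq /(nzAB q cq)[nA nB] ->]].
  rewrite cP' // (proj2 (aP q cq nA)) (proj2 (bP q cq nB)) uP // ?cvalX ?expf_neq0 // cvalM //.
  have := congr1 (fun p => cval p q) E0; rewrite /= !cvalM ?cvalX //; try exact: invarX.
  rewrite !expr_div_n; have := expf_neq0 r nA; have := expf_neq0 r nB.
  move: (cval A q ^+ r) (cval A' q ^+ r) (cval Bb q ^+ r) (cval B' q ^+ r) (cval c0 q) (cval e0 q).
  move=> x1 x2 x3 x4 x5 x6 n2 n4 E; rewrite [LHS]mulrA E.
  by field; rewrite n2 n4.
move=> W' h u' W'o W'z hr u'r E'.
have [G [H [Gi Hi G0 hP]]] := fraction_at_origin W'o W'z hr.
have [U [K [Ui Ki K0 u'P]]] := fraction_at_origin W'o W'z u'r.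
have Ai' := invarX r Ai; have Bi' := invarX r Bi.
(* For h = G / H and u' = U / K, clearing denominators puts G K A'^r in the colon ideal of the
   invariants. So it equals c0 t0, and the quotient sought is t = t0 / (H K A'^r). *)
have E1 : (G * K * A' ^+ r) * Bb ^+ r = A ^+ r * (U * H * B' ^+ r).
  apply: (@cval_identity _ _ (H * K * (A' * B'))); auto.
    apply: contraTneq isT => Z; have : (H * K * (A' * B'))`_0`_0 = 0 by rewrite Z !coef0.
    by move=> /eqP; rewrite !coef00M !mulf_eq0 (negPf G0) (negPf K0) (negPf A0) (negPf B0).
  move=> q cq; rewrite !cvalM ?cvalX; auto.
  rewrite !mulf_eq0 !negb_or => /andP[/andP[nH nK] /andP[nA nB]].
  have [Wq hq] := hP q cq nH; have [_ uq] := u'P q cq nK.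
  have := E' _ Wq; rewrite hq uq (proj2 (aP q cq nA)) (proj2 (bP q cq nB)).
  rewrite !expr_div_n; have := expf_neq0 r nA; have := expf_neq0 r nB.
  move: (cval A q ^+ r) (cval A' q ^+ r) (cval Bb q ^+ r) (cval B' q ^+ r) nH nK.
  move: (cval G q) (cval H q) (cval U q) (cval K q) => g h1 u1 k1 x1 x2 x3 x4 n1 n2 n4 n3.
  move=> /(congr1 (fun t => t * (h1 * k1 * x2 * x4))).
  have -> : g / h1 * (x3 / x4) * (h1 * k1 * x2 * x4) = g * k1 * x2 * x3 by field; rewrite n1 n4.
  by move=> ->; field; rewrite n2 n3.
have [|t0 ti tE] := H0 _ _ _ E1; first by auto.
have Di : inv (H * K * A' ^+ r) by auto.
have [t tr tP] := dopen_fraction ti Di.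
exists (dopen (H * K * A' ^+ r)), t; split=> //.
- exact: dopen_open.
- by apply: dopen_origin => //; rewrite !coef00M coef00X !mulf_neq0 // expf_neq0.
move=> x [q [cq nq ->]]; rewrite -[leval _ _]/(cval _ _) in nq.
rewrite cP' // tP //; move: nq; rewrite !cvalM //; last exact: invarM.
rewrite !mulf_eq0 !negb_or => /andP[/andP[nH nK] nA].
rewrite (proj2 (hP q cq nH)).
have := congr1 (fun p => cval p q) tE; rewrite /= !cvalM //; last exact: invarM.
move=> E; rewrite mulrA -E; move: (cval G q) (cval H q) (cval K q) (cval _ q) nH nK nA.
by move=> x1 x2 x3 x4 n2 n3 n4; field; rewrite n2 n3 n4.
Qed.

Lemma mono_exp i j n : mono i j ^+ n = mono (i * n) (j * n).
Proof. by rewrite /mono exprMn -polyC_exp -!exprM. Qed.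

(* The local class group has an element of order [r]: the class of the divisor
   of the ray through [v2]. *)
Lemma colon_principal_dvd p k : (r %| p * s + 1)%N -> colon_principal_at k origin ->
  (r %| k)%N.
Proof.
(* Both x^p y and x^(rp) are invariant, and in C[x, y] the ideal (A^k : Bb^k) is generated by
   y^k. *)
move=> rp Q; pose A := mono p 1; pose Bb := mono (r * p) 0.
have Ai : inv A by exact: invar_mono.
have Bi : inv Bb by apply: invar_mono; rewrite addn0 -mulnA dvdn_mulr.
pose D := dopen 1.
have Do : zariski_open D by exact: dopen_open.
have Dz : D origin by apply: dopen_origin => //; rewrite !coef1 oner_neq0.
have regular G : inv G -> exists2 f, regular_on D f & forall q, cone_of q = sigma -> f (pt q) = cval G q.
  move=> Gi; have [f fr fP] := dopen_fraction Gi invar1; exists f => // q cq.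
  by rewrite fP // cval1 ?divr1 ?oner_neq0.
have onD x : D x -> exists2 q, cone_of q = sigma & x = pt q.
  by move=> [q [cq _ ->]]; exists q.
have [a ar aP] := regular A Ai; have [b br bP] := regular Bb Bi.
have [W [c [u [Wo Wz [cr ur] E P]]]] := Q D a b Do Dz ar br.
have [G [G' [Gi G'i G0 cP]]] := fraction_at_origin Wo Wz cr.
have [U [U' [Ui U'i U0 uP]]] := fraction_at_origin Wo Wz ur.
have nz0 (H : B) : H`_0`_0 != 0 -> H != 0 by apply: contraNneq => ->; rewrite !coef0.
have E0 : U' * (G * Bb ^+ k) = A ^+ k * U * G'.
  apply: (@cval_identity _ _ (G' * U')); auto.
    by apply: nz0; rewrite coef00M mulf_neq0.
  move=> q cq; rewrite !cvalM ?cvalX; auto; rewrite mulf_eq0 negb_or => /andP[n1 n2].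
  have [Wq cq'] := cP q cq n1; have [_ uq] := uP q cq n2.
  have := E _ Wq; rewrite cq' uq aP // bP //.
  move: (cval G q) (cval G' q) (cval U q) (cval U' q) (cval A q ^+ k) (cval Bb q ^+ k) n1 n2.
  move=> x1 x2 x3 x4 x5 x6 n1 n2 /(congr1 (fun t => t * (x2 * x4))).
  have -> : x1 / x2 * x6 * (x2 * x4) = x4 * (x1 * x6) by field; rewrite n1.
  by move=> ->; field; rewrite n2.
(* The numerator [G] of [c] divides such an [H] up to a unit at the origin. This is applied to A^k
   and to y^(rk), the latter because y^(rk) Bb^k = A^(rk). *)
have quotient (H T : B) : inv H -> inv T -> H * Bb ^+ k = A ^+ k * T ->
    exists G1 T1 : B, G1`_0`_0 != 0 /\ G1 * H = G * T1.
  move=> Hi Ti HT; have [h hr hP] := regular H Hi; have [t tr tP] := regular T Ti.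
  have [|W'' [f [W''o W''z fr fE]]] := P D h t Do Dz hr tr.
    move=> x /onD[q cq ->]; rewrite hP // tP // aP // bP // -!cvalX // -!cvalM ?HT; auto.
  have [F [F' [Fi F'i F0 fP]]] := fraction_at_origin W''o W''z fr.
  exists (G' * F'), F; split; first by rewrite coef00M mulf_neq0.
  apply: (@cval_identity _ _ (G' * F')); auto.
    by apply: nz0; rewrite coef00M mulf_neq0.
  move=> q cq; rewrite !cvalM; auto; rewrite mulf_eq0 negb_or => /andP[n1 n2].
  have [Wq cq'] := cP q cq n1; have [W''q fq] := fP q cq n2.
  have := fE _ W''q; rewrite hP // cq' fq => ->.
  move: (cval G q) (cval G' q) (cval F q) (cval F' q) n1 n2 => x1 x2 x3 x4 n1 n2.
  by field; rewrite n1 n2.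
have [G1 [T1 [G10 E1]]] := quotient _ _ (invarX k Ai) (invarX k Bi) (erefl _).
have [|||G2 [T2 [G20 E2]]] := quotient (mono 0 (r * k)) (A ^+ (k * r.-1)).
- by apply: invar_mono; rewrite mul0n add0n dvdn_mulr.
- exact: invarX.
- rewrite !mono_exp !monoD; congr (mono _ _); case: (r) r_gt0 => // r' _ /=; nia.
apply: (@invar_colon_dvd _ r s z zP k (r * p * k) (r * k) G
  U' (('X^(p * k))%:P * U * G') G1 (T1 * ('X^((r * p * k) - p * k))%:P) G2 T2) => //.
- by rewrite leq_pmull.
- move: E0; rewrite !mono_exp mul1n mul0n /mono !polyC_exp !expr0 !mulr1 => ->; ring.
- have le : (p * k <= r * p * k)%N by rewrite -mulnA leq_pmull.
  rewrite [RHS]mulrA -E1 mono_exp mul1n /mono -mulrA; congr (_ * _).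
  by rewrite [RHS]mulrAC -polyCM -exprD subnKC // polyC_exp.
- by move: E2; rewrite /mono expr0 mul1r.
Qed.

End Chart.
End StalkProperty.

(** * Torus-invariant points *)

(* The image of [m |-> (m.v1, m.v2)] has index [det v1 v2]. *)
Lemma pairing_image (v1 v2 : lattice) : coprimez v1.1 v1.2 -> 0 < det v1 v2 ->
  exists s : nat, forall i j : nat,
  (exists m, idot m v1 = i%:Z /\ idot m v2 = j%:Z) <-> (`|det v1 v2| %| i * s + j)%N.
Proof.
move=> /coprimezP[[p q] /= pq] D0; pose D := det v1 v2.
pose e : int := p * v2.1 + q * v2.2.
(* The vectors m with <m, v1> = i are i (p, q) + t (-v1.2, v1.1), and their pairing with [v2] is i e
   + t D. So j must be congruent to i e modulo D, which makes s a residue of -e. *)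
exists `|((- e) %% D)%Z|%N => i j.
have sE : (`|((- e) %% D)%Z|%N)%:Z = - e - ((- e) %/ D)%Z * D.
  by rewrite gez0_abs ?modz_ge0 ?gt_eqF // {2}(divz_eq (- e) D) addrC addKr.
have key : (`|D| %| i * `|((- e) %% D)%Z| + j)%N = (D %| j%:Z - i%:Z * e)%Z.
  rewrite -[LHS]/(D %| (i * `|((- e) %% D)%Z| + j)%N%:Z)%Z PoszD PoszM sE.
  have -> : i%:Z * (- e - ((- e) %/ D)%Z * D) + j%:Z = (j%:Z - i%:Z * e) + (- (i%:Z * ((- e) %/ D)%Z)) * D by ring.
  by rewrite rpredDr // dvdz_mull.
rewrite key; split=> [[m [m1 m2]]|/dvdzP[t tE]].
  apply/dvdzP; exists (m.1 * - q + m.2 * p).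
  rewrite -m1 -m2 /e /D /det /idot.
  have -> : m.1 * v2.1 + m.2 * v2.2 = (m.1 * v2.1 + m.2 * v2.2) * (p * v1.1 + q * v1.2) by rewrite pq mulr1.
  by ring.
exists (i%:Z * p - t * v1.2, i%:Z * q + t * v1.1); split.
  by rewrite /idot /= -[RHS]mulr1 -pq; ring.
have -> : j%:Z = t * D + i%:Z * e by rewrite -tE; ring.
by rewrite /idot /e /D /det /=; ring.
Qed.

(** This provides the exponent p of the invariant monomial x^p y. A Bezout vector for [v2] is
    corrected by a multiple of (v2.2, -v2.1), which kills [v2] and pairs to det v1 v2 with [v1]; the
    factor |e| makes the first pairing nonnegative. *)
Lemma pairing_one (v1 v2 : lattice) : coprimez v2.1 v2.2 -> 0 < det v1 v2 ->
  exists p : nat, exists m, idot m v1 = p%:Z /\ idot m v2 = 1%N%:Z.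
Proof.
move=> /coprimezP[[x y] /= xy] D0; pose e := x * v1.1 + y * v1.2.
pose N : int := e + `|e| * det v1 v2.
exists `|N|%N, (x + `|e| * v2.2, y - `|e| * v2.1); split.
  rewrite gez0_abs; first by rewrite /N /idot /e /det /=; ring.
  have : `|e| * 1 <= `|e| * det v1 v2 by rewrite ler_wpM2l //; lia.
  by rewrite /N; lia.
by rewrite -[1%N%:Z]/(1 : int) -xy /idot /=; ring.
Qed.

Section Torus.
Variables (R : realType) (Sigma : set (set (R * R))).
Hypothesis separated : forall sigma tau, Sigma sigma -> Sigma tau ->
  exists m, [/\ dual_semigroup tau m, dual_semigroup sigma (- m) &
    forall n, dual_semigroup (sigma `&` tau) n -> exists k, dual_semigroup tau (n + m *+ k)].

(** The fixed point of the chart of a two-dimensional cone. The second clause, absence of nonzero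
    units in the semigroup, expresses that the cone is two-dimensional. *)
Definition distinguished (p : chart_point Sigma) :=
  (forall m, dual_semigroup (cone_of p) m -> eval_of p m = (m == 0)%:R) /\
  (forall m, dual_semigroup (cone_of p) m -> dual_semigroup (cone_of p) (- m) -> m = 0).

Lemma distinguished_invariant p : distinguished p -> torus_invariant_points (pt p).
Proof.
move=> [pE _] t q /(pt_eqP separated)[g [[g0 gM] gp gq]]; apply/(pt_eqP separated).
have c0 : character 0 t = 1 by rewrite /character !expr0z mulr1.
have cM m n : character (m + n) t = character m t * character n t.
  have /andP[t1 t2] := valP t.
  by rewrite /character !expfzDr // mulrACA.
apply: (glued_sym); exists (fun m => character m t * g m); split.
- split=> [|m n sm sn]; first by rewrite g0 c0 mulr1.
  by rewrite gM // cM mulrACA.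
- by move=> m sm; rewrite gp // pE //; case: eqP => [->|_]; rewrite ?mulr0 // c0 mulr1.
- by move=> m sm; rewrite gq.
Qed.

Lemma exprz2_neq1 (k : int) : k != 0 -> (2 : R[i]) ^ k != 1.
Proof.
have gt1 n : (1 : R[i]) < 2 ^+ n.+1 by rewrite exprn_egt1 // ltr1n.
by case: k => [[|n]|n] // _; rewrite /exprz ?invr_eq1 gt_eqF.
Qed.

(** For m nonzero, the character of m differs from 1 at (2, 1) or (1, 2), as 2 is not a root of
    unity; invariance then forces the value 0 at m. A unit of the semigroup has a nonzero value, so
    it is 0. *)
Lemma invariant_distinguished p : torus_invariant_points (pt p) -> distinguished p.
Proof.
move=> inv; have [p0 pM] := eval_ofP p.
have pE m : dual_semigroup (cone_of p) m -> eval_of p m = (m == 0)%:R.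
  move=> sm; have [->|m0] := eqVneq m 0; first by rewrite p0.
  have [t ct] : exists t : torus R, character m t != 1.
    have [m1|m1] := eqVneq m.1 0; last first.
      have tP : (((2, 1) : (R[i] * R[i])%type).1 != 0) && (((2, 1) : (R[i] * R[i])%type).2 != 0).
        by rewrite /= oner_neq0 pnatr_eq0.
      by exists (exist _ (2, 1) tP); rewrite /character /= exp1rz mulr1 exprz2_neq1.
    have m2 : m.2 != 0.
      by apply: contra m0 => /eqP m2; rewrite [m]surjective_pairing m1 m2.
    have tP : (((1, 2) : (R[i] * R[i])%type).1 != 0) && (((1, 2) : (R[i] * R[i])%type).2 != 0).
      by rewrite /= oner_neq0 pnatr_eq0.
    by exists (exist _ (1, 2) tP); rewrite /character /= exp1rz mul1r exprz2_neq1.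
  have := same_cone_eval separated (p := torus_act t p) (q := p) erefl (inv t p erefl) sm.
  move=> /= /eqP; rewrite -[X in _ == X]mul1r -subr_eq0 -mulrBl mulf_eq0 subr_eq0 (negPf ct).
  by move=> /eqP.
split=> // m sm sn; apply/eqP; apply: contraT => m0.
have := pM m (- m) sm sn; rewrite subrr p0 pE // (negPf m0) mul0r => /eqP.
by rewrite oner_eq0.
Qed.

End Torus.

(** * From transitivity on the fixed points to the bound *)

Section Main.
Variables (R : realType) (V : seq lattice).
Local Notation P := (convex_hull (R:=R) V).
Local Notation Sigma := (spanning_fan P).
Hypothesis V_pos : forall w : R * R, w <> 0 ->
  exists2 u, u \in V & 0 < dot w (lat R u).
Hypothesis V_coprime : forall v, exposed R V v -> coprimez v.1 v.2.

Let separated := fan_separated V_pos.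

Lemma edge_origin a b sigma : edge V a b -> Sigma sigma ->
  supports V sigma (normal a b) (det a b) ->
  exists p : chart_point Sigma, [/\ cone_of p = sigma, distinguished p,
    colon_principal_at `|det a b| (pt p) &
    forall k, colon_principal_at k (pt p) -> (`|det a b| %| k)%N].
Proof.
move=> E Ss sup; have [ea eb] := edge_exposed R E; have [_ _ D0 _] := E.
have dualE n := edge_dual n E sup.
have inj m m' : idot m a = idot m' a -> idot m b = idot m' b -> m = m'.
  move=> e1 e2.
  have E1 (x : lattice) : det a b * x.1 = idot x a * b.2 - idot x b * a.2 by rewrite /det /idot; ring.
  have E2 (x : lattice) : det a b * x.2 = idot x b * a.1 - idot x a * b.1 by rewrite /det /idot; ring.
  rewrite [m]surjective_pairing [m']surjective_pairing.
  by congr (_, _); apply: (mulfI (lt0r_neq0 D0)); rewrite ?E1 ?E2 e1 e2.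
have [s imageE] := pairing_image (V_coprime ea) D0.
have [d /imageE ds] := pairing_one (V_coprime eb) D0.
have r0 : (0 < `|det a b|)%N by rewrite absz_gt0 gt_eqF.
have [z zP] := prim_root_exists R[i] r0.
exists (plane Ss dualE 0 0); split=> //.
- split=> m /= sm.
    have [-> |m0] := eqVneq m 0; first by rewrite /deg1 /deg2 /idot /= !mul0r addr0 !expr0 mulr1.
    rewrite !expr0n -natrM mulnb; case: andP => // -[/eqP e1 /eqP e2].
    case/eqP: m0; apply: inj; rewrite ?[idot 0 _]/idot /= !mul0r addr0; [move: e1|move: e2];
    by rewrite /deg1 /deg2 => /eqP; rewrite absz_eq0 => /eqP.
  move=> sn; have [h1 h2] := (dualE _).1 sm; have [h3 h4] := (dualE _).1 sn.
  by apply: inj; rewrite [idot 0 _]/idot /= !mul0r addr0; move: h1 h2 h3 h4; rewrite !idotNl; lia.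
- exact: (colon_principal_origin separated r0 zP inj imageE).
- move=> k; exact: (colon_principal_dvd separated r0 zP inj imageE ds).
Qed.

Hypothesis aut_transitive : forall x y : toric_surface Sigma,
  torus_invariant_points x -> torus_invariant_points y ->
  exists2 phi, is_automorphism phi & phi x = y.

(** The colon property for the determinant of one edge is carried to the fixed point of the other,
    where it forces a divisibility; transitivity is used in both directions. *)
Lemma edge_det_eq a b a' b' : edge V a b -> edge V a' b' -> det a b = det a' b'.
Proof.
move=> E E'.
have [sigma Ss sup] := edge_supports V_pos E.
have [sigma' Ss' sup'] := edge_supports V_pos E'.
have [p [_ dp Qp Pp]] := edge_origin E Ss sup.
have [p' [_ dp' Qp' Pp']] := edge_origin E' Ss' sup'.
have ip := distinguished_invariant separated dp.
have ip' := distinguished_invariant separated dp'.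
have [phi aut e] := aut_transitive ip ip'; have [phi' aut' e'] := aut_transitive ip' ip.
have d1 : (`|det a b| %| `|det a' b'|)%N.
  by apply: Pp; apply: (automorphism_colon aut); rewrite e.
have d2 : (`|det a' b'| %| `|det a b|)%N.
  by apply: Pp'; apply: (automorphism_colon aut'); rewrite e'.
have : `|det a b|%N = `|det a' b'|%N by apply/eqP; rewrite eqn_dvd d1.
by case: E E' => _ _ D _ [_ _ D' _]; lia.
Qed.

Lemma invariant_edge (x : toric_surface Sigma) : torus_invariant_points x ->
  exists a b (p : chart_point Sigma),
  [/\ edge V a b, x = pt p, distinguished p & supports V (cone_of p) (normal a b) (det a b)].
Proof.
have [p ->] := pt_surj x; move=> /(invariant_distinguished separated) dp.
have [a [b [E sup]]] := full_cone_edge V_pos (cone_ofP p) dp.2.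
by exists a, b, p; split.
Qed.

Lemma distinguished_eq (p p' : chart_point Sigma) : distinguished p -> distinguished p' ->
  (forall m, dual_semigroup (cone_of p) m <-> dual_semigroup (cone_of p') m) -> pt p = pt p'.
Proof.
move=> [pE _] [p'E full] D; apply/(pt_eqP separated).
have [m [m1 m2 S]] := separated (cone_ofP p) (cone_ofP p').
have m0 : m = 0 by apply: full => //; apply/D.
have sub n : dual_semigroup (cone_of p `&` cone_of p') n -> dual_semigroup (cone_of p) n.
  by move=> /S[k]; rewrite m0 mul0rn addr0 => /D.
exists (eval_of p); split=> //; last by move=> n sn; rewrite p'E // pE //; apply/D.
by have [p0 pM] := eval_ofP p; split=> // m' n' /sub sm /sub sn; exact: pM.
Qed.

Lemma card_invariant : (@torus_invariant_points R Sigma #<= `I_6)%card.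
Proof.
(* Any nonzero vector would do: it only serves to produce a reference edge. *)
have [a0 [b0 [E0 _ _]]] : exists a b, [/\ edge V a b, 0 <= det a (1, 0) & 0 < det (1, 0) b].
  by apply: (edge_at V_pos).
have edet a b : edge V a b -> det a b = det a0 b0 by move=> E; exact: edge_det_eq.
have eprim a b : edge V a b -> coprimez b.1 b.2.
  by move=> E; apply: V_coprime; exact: (edge_exposed R E).2.
have ex (x : toric_surface Sigma) : exists v, torus_invariant_points x ->
    exists b (p : chart_point Sigma),
    [/\ edge V v b, x = pt p, distinguished p & supports V (cone_of p) (normal v b) (det v b)].
  have [/invariant_edge[a [b [p H]]]|N] := pselect (torus_invariant_points x).
    by exists a => _; exists b, p.
  by exists 0.
have [f fP] := choice ex.
(* A fixed point is encoded by the starting vertex of its edge. That vertex determines the edge by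
   [edge_inj], hence the dual semigroup and the fixed point. *)
pose g x := vertex_code (det a0 b0) a0 b0 (f x).
have ginj : {in @torus_invariant_points R Sigma &, injective g}.
  move=> x y; rewrite !inE => ix iy gxy.
  have [b [p [E xE dp sup]]] := fP x ix; have [b' [p' [E' yE dp' sup']]] := fP y iy.
  have fxy : f x = f y.
    apply: (vertex_code_inj V_pos edet eprim E0 _ _ gxy).
      exact: (edge_exposed R E).1.
    exact: (edge_exposed R E').1.
  rewrite -fxy in E' sup'.
  have bb := edge_inj edet E E'; rewrite -bb in sup'.
  rewrite xE yE; apply: distinguished_eq => // m.
  by rewrite (edge_dual m E sup) (edge_dual m E sup').
have h : (g @` @torus_invariant_points R Sigma #<= `I_6)%card.
  by apply: subset_card_le => _ [x _ <-]; exact: vertex_code_lt.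
by rewrite -(card_le_eql (inj_card_eq ginj)).
Qed.

End Main.

Local Open Scope card_scope.

Theorem corollary1p8 (R : realType) (P : set (R * R)) (hP : LDP_polygon P)
    (htrans : forall x y : toric_del_Pezzo P,
        torus_invariant_points x -> torus_invariant_points y ->
        exists2 phi : toric_del_Pezzo P -> toric_del_Pezzo P,
          is_automorphism phi & phi x = y) :
  (@torus_invariant_points R (spanning_fan P)) #<= `I_6.
Proof.
case: hP htrans => -[V ->] int0 prim htrans.
have V_pos w := @interior_pos R V w int0.
apply: card_invariant => // v ev.
have [u /lat_inj -> /primitive_coprime //] := prim _ (exposed_vertex ev).
Qed.
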